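(* Fix $d\ge1$. For all partitions $\mu\subseteq\lambda$ with $\ell(\lambda)\le d$ (set $\lambda_i=0$ for $i>\ell(\lambda)$), as rational functions in $\beta$, $$\sum_{T\in\operatorname{SIT}(\lambda/\mu)}\prod_{k=1}^{m(T)}\left(\left[\prod_{i=1}^d\frac{1+\beta\big(\nu_i(T_{<k})+d-i+1\big)}{1+\beta(\lambda_i+d-i+1)}\right]-1\right)^{-1} =\prod_{i=1}^d\big(1+\beta(\lambda_i+d-i+1)\big)^{\lambda_i}\sum_{T\in\operatorname{SSVT}_d(\mu)}(-\beta)^{\operatorname{ne}(T)-|\lambda|}\prod_{(i,j)\in\mu,\ r\in T(i,j)}\frac{\lambda_{d+1-r}+i-j}{1+\beta(\lambda_{d+1-r}+r)}\prod_{(i,j)\in\lambda}\frac{1}{h(i,j)}.$$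
   Context: Partitions are identified with Young diagrams $\{(i,j):1\le j\le\lambda_i\}$ (English convention); $h(i,j)=\lambda_i-j+\lambda'_j-i+1$ is the hook length in $\lambda$ ($\lambda'$ conjugate), $|\cdot|$ counts cells. A standard increasing tableau of shape $\lambda/\mu$ is a filling $T$ of the cells of $\lambda/\mu$ by positive integers, strictly increasing along rows and down columns, with set of entries $\{1,\dots,m\}$ for some $m=m(T)$; $\operatorname{SIT}(\lambda/\mu)$ is their set; $\nu(T_{<k})$ is the partition whose diagram is $\mu$ together with the cells of $\lambda/\mu$ with entry $<k$, with parts $\nu_i(T_{<k})$. $\operatorname{SSVT}_d(\mu)$ is the set of semistandard set-valued tableaux of shape $\mu$ with entries in $\{1,\dots,d\}$: assignments of a nonempty subset $T(u)\subseteq\{1,\dots,d\}$ to each cell $u$ of $\mu$ such that $\max T(u)\le\min T(u')$ when $u'$ is immediately right of $u$, and $\max T(u)<\min T(u')$ when $u'$ is immediately below $u$. $\operatorname{ne}(T)=\sum_u|T(u)|$ is the number of entries. *)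

(* Defs.v *)
From HB Require Import structures.
From mathcomp Require Import all_boot all_order all_algebra.
Set Implicit Arguments. Unset Strict Implicit. Unset Printing Implicit Defensive.
Import Order.TTheory GRing.Theory Num.Theory.

Definition is_partition (s : seq nat) : bool :=
  sorted geq s && all (fun x => 0 < x) s.
Definition part (s : seq nat) (i : nat) : nat := nth 0 s i.-1.

Definition cells (s : seq nat) : seq (nat * nat) :=
  [seq (i.+1, j.+1) | i <- iota 0 (size s), j <- iota 0 (nth 0 s i)].

Definition skew (lam mu : seq nat) : seq (nat * nat) :=
  [seq c <- cells lam | c \notin cells mu].

Definition conj_part (s : seq nat) (j : nat) : nat := count (fun p => j <= p) s.
Definition hook (s : seq nat) (c : nat * nat) : nat :=
  (part s c.1 - c.2) + (conj_part s c.2 - c.1) + 1.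

(* ---- Standard increasing tableaux of shape lam/mu ----
   A filling of the N = |lam/mu| cells is encoded as an N-tuple (entries
   indexed by the position of the cell in  skew lam mu ); since entries of a
   SIT form {1..m} with m <= N, every SIT is realised exactly once by a tuple
   with entries in 'I_N.+1. *)
Section SIT.
Variables (lam mu : seq nat).
Local Notation s := (skew lam mu).
Local Notation N := (size (skew lam mu)).

Definition sit_entry (T : N.-tuple 'I_N.+1) (c : nat * nat) : nat :=
  nth 0 (map (@nat_of_ord _) T) (index c s).

Definition sit_m (T : N.-tuple 'I_N.+1) : nat := \max_(c <- s) sit_entry T c.

Definition is_SIT (T : N.-tuple 'I_N.+1) : bool :=
  [&& all (fun c => 0 < sit_entry T c) s,
      all (fun c => all (fun c' =>
          ((c.1 == c'.1) && (c.2 < c'.2)) ==> (sit_entry T c < sit_entry T c')) s) s,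
      all (fun c => all (fun c' =>
          ((c.2 == c'.2) && (c.1 < c'.1)) ==> (sit_entry T c < sit_entry T c')) s) s
    & all (fun k => has (fun c => sit_entry T c == k) s) (iota 1 (sit_m T))].

Definition sit_nu (T : N.-tuple 'I_N.+1) (k i : nat) : nat :=
  count (fun c => (c.1 == i) &&
                  ((c \in cells mu) || ((c \in s) && (sit_entry T c < k))))
        (cells lam).
End SIT.

(* ---- Semistandard set-valued tableaux of shape mu, entries in {1..d} ----
   The cells of mu are indexed by 'I_(size (cells mu)); an entry r in {1..d}
   is encoded by a : 'I_d with r = a + 1. *)
Section SSVT.
Variables (d : nat) (mu : seq nat).
Local Notation M := (size (cells mu)).

Definition mcell (k : 'I_M) : nat * nat := nth (0, 0) (cells mu) k.

Definition is_SSVT (T : {ffun 'I_M -> {set 'I_d}}) : bool :=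
  [&& [forall k, T k != set0],
      [forall k, forall k',
        (((mcell k').1 == (mcell k).1) && ((mcell k').2 == (mcell k).2.+1)) ==>
        [forall a in T k, forall b in T k', (a : nat) <= b]]
    & [forall k, forall k',
        (((mcell k').1 == (mcell k).1.+1) && ((mcell k').2 == (mcell k).2)) ==>
        [forall a in T k, forall b in T k', (a : nat) < b]]].

Definition ne (T : {ffun 'I_M -> {set 'I_d}}) : nat := \sum_(k < M) #|T k|.
End SSVT.

Local Open Scope ring_scope.

Definition LHS68 (R : fieldType) (beta : R) (d : nat) (lam mu : seq nat) : R :=
  \sum_(T : (size (skew lam mu)).-tuple 'I_(size (skew lam mu)).+1 | is_SIT T)
    \prod_(1 <= k < (sit_m T).+1)
      ((\prod_(i < d)
          ((1 + beta * ((sit_nu T k i.+1 + (d - i))%N)%:R) /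
           (1 + beta * ((part lam i.+1 + (d - i))%N)%:R))) - 1)^-1.

Definition RHS68 (R : fieldType) (beta : R) (d : nat) (lam mu : seq nat) : R :=
  (\prod_(i < d) (1 + beta * ((part lam i.+1 + (d - i))%N)%:R) ^+ part lam i.+1)
  * (\sum_(T : {ffun 'I_(size (cells mu)) -> {set 'I_d}} | is_SSVT T)
       ((- beta) ^ ((ne T)%:Z - (sumn lam)%:Z)
        * \prod_(k < size (cells mu)) \prod_(a in T k)
            (((part lam (d - a))%:R + ((mcell k).1)%:R - ((mcell k).2)%:R)
             / (1 + beta * ((part lam (d - a) + a.+1)%N)%:R))))
  * \prod_(c <- cells lam) ((hook lam c)%:R)^-1.

Definition betaX : {fraction {poly rat}} := tofrac 'X.

(* Main.v *)
Require Import Defs.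
From HB Require Import structures.
From mathcomp Require Import all_boot all_order all_algebra.
From mathcomp Require Import zify ring.
Set Implicit Arguments. Unset Strict Implicit. Unset Printing Implicit Defensive.
Import Order.TTheory GRing.Theory Num.Theory.
Local Open Scope ring_scope.

(** Put [y_r = lam_{d+1-r} + r], [X_r = 1 / (1 + beta y_r)] and
    [A_c = 1 + beta c].  The factor of an entry [r] of cell [(i, j)], times
    [- beta], is [X_r A_{r+j-i} - 1], so the right-hand side is, up to a
    constant, a factorial Grothendieck polynomial
    [S_mu = sum_T prod (X_r A_{r+j-i} - 1)].  It satisfies the Pieri rule
    [sum_nu S_nu = (prod_r X_r) (prod_i A_{mu_i+d-i+1}) S_mu], the sum being over
    all [nu] obtained from [mu] by adding a (possibly empty) set of corners.  The
    left-hand side satisfies the same recursion: remove the cells of entry 1.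
    Both agree at [mu = lam], where a single tableau contributes to [S_lam], and
    [S_nu = 0] unless [nu] is contained in [lam].

    The Pieri rule is proved by induction on the number of variables.  Deleting
    the largest entry expresses [S_mu] through a transfer matrix; in terms of the
    beta-sets [a_i = mu_i + k + 1 - i], the rule says that adding corners to [a]
    and removing corners from [b] agree up to [x prod A_{a_i} / prod A_{b_i}].
    Both sums factor over the rows, and the row factors agree up to a
    telescoping term. *)

(** * The one-variable transfer matrix *)

(** The empty set of corners contributes [S_mu] to the Pieri sum. Moving it to the other side leaves
    [S_mu] times the bracket minus 1 of the theorem, and dividing by that number produces the
    inverse in each factor of the left-hand side. The division is possible because at beta = 1 the
    product in the bracket is less than 1 as soon as [mu != lam]. The obstacle in the Pieri rule is
    that the induction hypothesis concerns corners added to the smaller shape, whereas branching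
    [S_(mu+e)] produces corners added to the larger one. Exchanging them for corners removed from
    the smaller shape [rho] settles this: if [kap] is [rho] without these corners, then [rho] is
    [kap] with corners added, and for fixed [kap] the sum over [rho] is the one in the induction
    hypothesis. The denominators [prod A_(b_i)] are taken at [kap], so they cancel the factor
    supplied by that hypothesis. Row factors cannot agree one by one, because raising row [i+1] of
    [a] is compared with lowering row [i] of [b]; this shift is what the telescoping term
    absorbs. *)

Section Transfer.
Variables (R : fieldType) (x : R) (A : nat -> R).

(* [transfer k a b] is the weight of deleting the largest entry, from the shape
   with beta-set [a_0 > ... > a_k > 0] to the one with beta-set
   [b_0 > ... > b_k = 0]: [row_wt] collects the cells of the horizontal strip,
   and [link_wt] the corners of the smaller shape which may or may not carry the
   deleted entry next to smaller ones, [1 + (x A_b - 1) = x A_b]. *)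
Definition gap_wt (a b : nat) : R := \prod_(b.+1 <= c < a) (x * A c - 1).
Definition row_wt (a b : nat) : R := if (b < a)%N then gap_wt a b else 0.
Definition link_wt (b a : nat) : R :=
  if (a < b)%N then x * A b else if a == b then 1 else 0.
Definition transfer (k : nat) (a b : nat -> nat) : R :=
  \prod_(i < k.+1) row_wt (a i) (b i) * \prod_(i < k) link_wt (b i) (a i.+1).

Lemma row_wtS (a b : nat) :
  row_wt a.+1 b = if (b < a)%N then gap_wt a b * (x * A a - 1)
                  else if a == b then 1 else 0.
Proof.
rewrite /row_wt ltnS leq_eqVlt /gap_wt [b == a]eq_sym.
case: eqP => [->|_] /=; first by rewrite ltnn big_geq.
by case: ltnP => // ltba; rewrite big_nat_recr.
Qed.

Lemma row_wt_pred (a b : nat) : (0 < b)%N ->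
  row_wt a b.-1 = if (b < a)%N then gap_wt a b * (x * A b - 1)
                  else if a == b then 1 else 0.
Proof.
case: b => // b _; rewrite /row_wt /gap_wt /= leq_eqVlt [b.+1 == a]eq_sym.
case: eqP => [->|_] /=; first by rewrite ltnn big_geq.
by case: ltnP => // ltba; rewrite [LHS]big_ltn // mulrC.
Qed.

(** The telescoping term of a row is the quotient of [diag_wt] by [weak_wt]. The two are kept apart
    because [weak_wt] vanishes when [a < b]. *)
Definition diag_wt (a b : nat) : R := if a == b then x * A a else 1.
Definition weak_wt (a b : nat) : R := if (b <= a)%N then gap_wt a b else 0.

(** Here [a, b] belong to row [i] and [a', b'] to row [i+1]. In [up_wt] the part [a'] may rise, in
    [down_wt] the part [b] may drop; the guards say, in terms of beta-sets, that the row offers a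
    corner. *)
Definition up_wt (a b a' b' : nat) : R :=
  row_wt a' b' * link_wt b a'
  + (if (a'.+1 < a)%N then row_wt a'.+1 b' * link_wt b a'.+1 else 0).
Definition down_wt (a b a' b' : nat) : R :=
  row_wt a b * link_wt b a' / A b
  + (if (b' < b.-1)%N then row_wt a b.-1 * link_wt b.-1 a' / A b.-1 else 0).

Hypothesis x_neq0 : x != 0.
Hypothesis A_neq0 : forall c, A c != 0.

(* [up_wt] and [down_wt] differ only by factors that telescope along the rows. *)
Lemma up_down_local (a b a' b' : nat) : (a' < a)%N -> (b' < b)%N ->
  up_wt a b a' b' * diag_wt a' b' * weak_wt a b
  = diag_wt a b * A a' * down_wt a b a' b' * weak_wt a' b'.
Proof.
move=> lta ltb; have g0 u : gap_wt u u = 1 by rewrite /gap_wt big_geq.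
rewrite /up_wt /down_wt row_wtS row_wt_pred; last by lia.
case: b ltb => // b ltb; rewrite /diag_wt /weak_wt /row_wt /link_wt /=.
have := A_neq0 b; have := A_neq0 b.+1.
move=> A1 A2.
repeat (case: ifP => ?; try (exfalso; lia));
  repeat match goal with H : is_true (?u == ?v) |- _ =>
    move/eqP: H => H; subst end;
  rewrite ?g0; try (by field; rewrite ?A1 ?A2).
(* The case left over has the original [b] equal to [a'.+1], which follows only from the
   inequalities in the context. *)
have eq_a'b : a' = b by lia.
by subst a'; field; rewrite A1 A2.
Qed.

(** Membership extended by false to all of [nat], so that a set of rows acts on shapes given as
    infinite sequences. *)
Definition at_row (k : nat) (e : {set 'I_k}) (i : nat) : bool :=
  [exists u in e, u == i :> nat].

Lemma at_row_ord (k : nat) (e : {set 'I_k}) (u : 'I_k) :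
  at_row e u = (u \in e).
Proof.
apply/existsP/idP => [[v /andP[ve /eqP/val_inj <-]] //|ue].
by exists u; rewrite ue eqxx.
Qed.

Lemma at_row_ge (k : nat) (e : {set 'I_k}) (i : nat) :
  (k <= i)%N -> at_row e i = false.
Proof.
move=> ki; apply/existsP => -[v /andP[_ /eqP vi]].
by have := ltn_ord v; rewrite vi ltnNge ki.
Qed.

Definition raise (k : nat) (f : nat -> nat) (e : {set 'I_k}) (i : nat) : nat :=
  f i + at_row e i.
Definition lower (k : nat) (f : nat -> nat) (e : {set 'I_k}) (i : nat) : nat :=
  f i - at_row e i.

(** Distributivity: each index decides independently whether it belongs to [e], a forbidden choice
    having weight 0. *)
Lemma sum_subsets_prod (k : nat) (ok : 'I_k -> bool) (F : 'I_k -> bool -> R) :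
  \sum_(e : {set 'I_k} | [forall u in e, ok u]) \prod_(u < k) F u (u \in e)
  = \prod_(u < k) (F u false + (if ok u then F u true else 0)).
Proof.
under [RHS]eq_bigr do rewrite addrC.
rewrite bigA_distr big_mkcond /=; apply: eq_bigr => e _.
case: ifPn => [/forall_inP ok_e|/forall_inPn[u ue /negbTE nok]].
  by apply: eq_bigr => u _; case: ifP => // ue; rewrite ok_e.
by rewrite (bigD1 u) //= ue nok mul0r.
Qed.

(** Each [a i] is grouped with its row factor and its link to the row above. Row 0 has no such link
    and may always rise, hence the separate factor. *)
Lemma sum_transfer_raise (k : nat) (a b : nat -> nat) :
  \sum_(e : {set 'I_k.+1} | [forall i in e, (i == 0%N :> nat) || ((a i).+1 < a i.-1)%N])
     transfer k (raise a e) b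
  = (row_wt (a 0%N) (b 0%N) + row_wt (a 0%N).+1 (b 0%N))
    * \prod_(i < k) up_wt (a i) (b i) (a i.+1) (b i.+1).
Proof.
pose F (u : 'I_k.+1) (h : bool) : R :=
  row_wt (a u + h)%N (b u) * (if (u : nat) is j.+1 then link_wt (b j) (a u + h)%N else 1).
under eq_bigr => e _.
  have -> : transfer k (raise a e) b = \prod_(u < k.+1) F u (u \in e).
    rewrite /transfer /F big_split /=; congr (_ * _).
      by apply: eq_bigr => u _; rewrite /raise at_row_ord.
    rewrite [RHS]big_ord_recl mul1r; apply: eq_bigr => u _.
    by rewrite /raise -at_row_ord.
  over.
rewrite sum_subsets_prod big_ord_recl /F /= !mulr1 addn0 addn1; congr (_ * _).
by apply: eq_bigr => u _; rewrite /up_wt /bump /= add1n addn0 addn1.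
Qed.

(** Each [b i] is grouped with its link to the row below, so the row left over is the last one,
    which never drops. *)
Lemma sum_transfer_lower (k : nat) (a b : nat -> nat) :
  \sum_(e : {set 'I_k} | [forall i in e, (b i.+1 < (b i).-1)%N])
     transfer k a (lower b e) / \prod_(i < k) A (lower b e i)
  = \prod_(i < k) down_wt (a i) (b i) (a i.+1) (b i.+1) * row_wt (a k) (b k).
Proof.
pose F (u : 'I_k) (h : bool) : R :=
  row_wt (a u) (b u - h)%N * link_wt (b u - h)%N (a u.+1) / A (b u - h)%N.
under eq_bigr => e _.
  have -> : transfer k a (lower b e) / \prod_(i < k) A (lower b e i)
    = (\prod_(u < k) F u (u \in e)) * row_wt (a k) (b k).
    rewrite /transfer /F big_split big_split /= prodfV big_ord_recr /=.
    have -> : lower b e k = b k by rewrite /lower at_row_ge // subn0.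
    have lowerE (i : 'I_k) : lower b e i = (b i - (i \in e))%N.
      by rewrite /lower at_row_ord.
    have -> : \prod_(i < k) row_wt (a i) (lower b e i)
        = \prod_(i < k) row_wt (a i) (b i - (i \in e))%N.
      by apply: eq_bigr => i _; rewrite lowerE.
    have -> : \prod_(i < k) link_wt (lower b e i) (a i.+1)
        = \prod_(i < k) link_wt (b i - (i \in e))%N (a i.+1).
      by apply: eq_bigr => i _; rewrite lowerE.
    have -> : \prod_(i < k) A (lower b e i) = \prod_(i < k) A (b i - (i \in e))%N.
      by apply: eq_bigr => i _; rewrite lowerE.
    by ring.
  over.
rewrite -mulr_suml sum_subsets_prod; congr (_ * _).
by apply: eq_bigr => u _; rewrite /F /down_wt subn0 subn1.
Qed.

Lemma transfer_exchange (k : nat) (a b : nat -> nat) :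
  (forall i, i < k -> a i.+1 < a i)%N -> (forall i, i < k -> b i.+1 < b i)%N ->
  (0 < a k)%N -> b k = 0%N ->
  \sum_(e : {set 'I_k.+1} | [forall i in e, (i == 0%N :> nat) || ((a i).+1 < a i.-1)%N])
     transfer k (raise a e) b
  = x * \prod_(i < k.+1) A (a i) *
    \sum_(e : {set 'I_k} | [forall i in e, (b i.+1 < (b i).-1)%N])
       (transfer k a (lower b e) / \prod_(i < k) A (lower b e i)).
Proof.
move=> lta ltb ak bk; rewrite sum_transfer_raise sum_transfer_lower.
(* The identity cut after row [m], with the two halves of the telescoping term as boundary factors.
   At [m = k], [b k = 0 < a k] makes [diag_wt] equal to 1 and [weak_wt] equal to the missing
   [row_wt]. *)
suff /(_ k (leqnn k)) : forall m, (m <= k)%N ->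
    (row_wt (a 0%N) (b 0%N) + row_wt (a 0%N).+1 (b 0%N))
      * \prod_(i < m) up_wt (a i) (b i) (a i.+1) (b i.+1) * diag_wt (a m) (b m)
    = x * \prod_(i < m.+1) A (a i)
      * (\prod_(i < m) down_wt (a i) (b i) (a i.+1) (b i.+1) * weak_wt (a m) (b m)).
  by rewrite /diag_wt /weak_wt /row_wt bk ak leq0n gtn_eqF // mulr1.
elim=> [_|m IHm ltmk].
  rewrite big_ord0 big_ord1 big_ord0 row_wtS /row_wt /diag_wt /weak_wt.
  case: ltngtP => [_|_|->]; try ring.
  by rewrite /gap_wt big_geq //; ring.
have loc := up_down_local (lta m ltmk) (ltb m ltmk).
have IH := IHm (ltnW ltmk).
rewrite big_ord_recr [\prod_(i < m.+1) down_wt _ _ _ _]big_ord_recr big_ord_recr /=.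
(* Of the two boundary factors of row [m], only this one is known to be invertible. *)
have tau0 : diag_wt (a m) (b m) != 0.
  by rewrite /diag_wt; case: (a m == b m); [exact: mulf_neq0 | exact: oner_neq0].
apply: (mulfI tau0).
transitivity (x * (\prod_(i < m.+1) A (a i))
  * (\prod_(i < m) down_wt (a i) (b i) (a i.+1) (b i.+1) * weak_wt (a m) (b m))
  * (up_wt (a m) (b m) (a m.+1) (b m.+1) * diag_wt (a m.+1) (b m.+1))).
  by rewrite -IH; ring.
rewrite -mulrA -[X in _ * X]mulrA [weak_wt _ _ * _]mulrC loc; ring.
Qed.
End Transfer.

(** * Set-valued tableaux and their branching *)

Definition nonincr (mu : nat -> nat) : Prop := forall i, (mu i.+1 <= mu i)%N.

Lemma nonincr_leq (mu : nat -> nat) (i j : nat) :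
  nonincr mu -> (i <= j)%N -> (mu j <= mu i)%N.
Proof.
move=> mu_dec; elim: j => [|j IHj]; first by rewrite leqn0 => /eqP->.
rewrite leq_eqVlt => /predU1P[->//|]; rewrite ltnS => /IHj.
exact: leq_trans (mu_dec j).
Qed.

(** Sums over shapes need a finite type, while the combinatorics uses sequences on [nat]; padding
    with 0 links the two. *)
Definition extend (k n : nat) (f : {ffun 'I_k -> 'I_n}) (i : nat) : nat :=
  if insub i is Some u then f u else 0.

Lemma extend_ord (k n : nat) (f : {ffun 'I_k -> 'I_n}) (u : 'I_k) :
  extend f u = f u.
Proof. by rewrite /extend valK. Qed.

Lemma extend_ge (k n : nat) (f : {ffun 'I_k -> 'I_n}) (i : nat) :
  (k <= i)%N -> extend f i = 0%N.
Proof. by move=> ki; rewrite /extend insubN // -leqNgt. Qed.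

Lemma extend_inj (k n : nat) (f g : {ffun 'I_k -> 'I_n}) :
  (forall i, (i < k)%N -> extend f i = extend g i) -> f = g.
Proof.
by move=> fg; apply/ffunP => u; apply: val_inj; rewrite /= -!extend_ord fg.
Qed.

Section Triples.
Variables d n : nat.
Local Notation triple := ('I_d * 'I_n * 'I_d)%type.

Definition has_entry (T : {set triple}) (i j r : nat) : bool :=
  [exists t in T, [&& t.1.1 == i :> nat, t.1.2 == j :> nat & t.2 == r :> nat]].
Definition entries (P : nat -> nat -> nat -> bool) : {set triple} :=
  [set t : triple | P t.1.1 t.1.2 t.2].

Lemma has_entry_ord (T : {set triple}) (i : 'I_d) (j : 'I_n) (r : 'I_d) :
  has_entry T i j r = ((i, j, r) \in T).
Proof.
apply/exists_inP/idP => [[[[i' j'] r'] tT /=]|tT]; last first.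
  by exists (i, j, r) => //=; rewrite !eqxx.
by move=> /and3P[/eqP/val_inj <- /eqP/val_inj <- /eqP/val_inj <-].
Qed.

Lemma has_entry_lt (T : {set triple}) (i j r : nat) :
  has_entry T i j r -> [/\ (i < d)%N, (j < n)%N & (r < d)%N].
Proof. by move=> /exists_inP[t _ /and3P[/eqP<- /eqP<- /eqP<-]]. Qed.

Lemma has_entry_inj (T U : {set triple}) :
  (forall i j r, has_entry T i j r = has_entry U i j r) -> T = U.
Proof. by move=> TU; apply/setP => -[[i j] r]; rewrite -!has_entry_ord TU. Qed.

Lemma has_entries (P : nat -> nat -> nat -> bool) (i j r : nat) :
  has_entry (entries P) i j r = [&& i < d, j < n, r < d & P i j r]%N.
Proof.
apply/idP/idP => [Pijr|/and4P[id jn rd]]; last first.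
  by rewrite (has_entry_ord _ (Ordinal id) (Ordinal jn) (Ordinal rd)) inE.
have [id jn rd] := has_entry_lt Pijr; rewrite id jn rd /=; move: Pijr.
by rewrite (has_entry_ord _ (Ordinal id) (Ordinal jn) (Ordinal rd)) inE.
Qed.

Lemma has_entryU (T U : {set triple}) (i j r : nat) :
  has_entry (T :|: U) i j r = has_entry T i j r || has_entry U i j r.
Proof.
apply/exists_inP/orP => [[t] /setUP[tT|tU] tE|[] /exists_inP[t tT tE]].
- by left; apply/exists_inP; exists t.
- by right; apply/exists_inP; exists t.
- by exists t; rewrite // inE tT.
- by exists t; rewrite // inE tT orbT.
Qed.

(* A set-valued tableau is the set of its triples ((row, column), entry), all
   counted from 0.  Distant cells are compared directly, which is equivalent to
   comparing adjacent ones when [mu] is a partition. *)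
Definition svt (k : nat) (mu : nat -> nat) (T : {set triple}) : bool :=
  [&& [forall t in T, (t.2 < k)%N && (t.1.2 < mu t.1.1)%N],
      [forall i : 'I_d, forall j : 'I_n, (j < mu i)%N ==> [exists r : 'I_d, (i, j, r) \in T]],
      [forall t in T, forall u in T,
         (t.1.1 == u.1.1) && (t.1.2 < u.1.2)%N ==> (t.2 <= u.2)%N]
    & [forall t in T, forall u in T,
         (t.1.2 == u.1.2) && (t.1.1 < u.1.1)%N ==> (t.2 < u.2)%N]].

Lemma svtP (k : nat) (mu : nat -> nat) (T : {set triple}) :
  (forall i, (mu i <= n)%N) ->
  reflect [/\ forall i j r, has_entry T i j r -> (r < k)%N /\ (j < mu i)%N,
    forall i j, (i < d)%N -> (j < mu i)%N -> exists r, has_entry T i j r,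
    forall i j j' r r', has_entry T i j r -> has_entry T i j' r' ->
      (j < j')%N -> (r <= r')%N
  & forall i i' j r r', has_entry T i j r -> has_entry T i' j r' ->
      (i < i')%N -> (r < r')%N]
  (svt k mu T).
Proof.
move=> mu_n; apply: (iffP and4P) => -[].
  move=> /forall_inP T1 /forallP T2 /forall_inP T3 /forall_inP T4; split.
  - by move=> i j r /exists_inP[t tT /and3P[/eqP<- /eqP<- /eqP<-]]; apply/andP/T1.
  - move=> i j id jmu; have jn := leq_trans jmu (mu_n i).
    have /forallP/(_ (Ordinal jn))/implyP/(_ jmu)/existsP[r ijr] := T2 (Ordinal id).
    by exists r; rewrite -has_entry_ord in ijr.
  - move=> i j j' r r' /exists_inP[t tT /and3P[/eqP ti /eqP<- /eqP<-]].
    move=> /exists_inP[u uT /and3P[/eqP ui /eqP<- /eqP<-]] ltj.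
    have /forall_inP/(_ u uT)/implyP := T3 t tT; apply.
    by rewrite ltj -val_eqE /= ti ui eqxx.
  - move=> i i' j r r' /exists_inP[t tT /and3P[/eqP<- /eqP tj /eqP<-]].
    move=> /exists_inP[u uT /and3P[/eqP<- /eqP uj /eqP<-]] lti.
    have /forall_inP/(_ u uT)/implyP := T4 t tT; apply.
    by rewrite lti -val_eqE /= tj uj eqxx.
move=> T1 T2 T3 T4; split.
- apply/forall_inP => -[[i j] r] tT; apply/andP.
  by apply: (T1 i j r); rewrite has_entry_ord.
- apply/forallP => i; apply/forallP => j; apply/implyP => jmu; apply/existsP.
  have [r ijr] := T2 i j (ltn_ord i) jmu; have [_ _ rd] := has_entry_lt ijr.
  by exists (Ordinal rd); rewrite -has_entry_ord.
- apply/forall_inP => -[[i j] r] tT; apply/forall_inP => -[[i' j'] r'] uT.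
  apply/implyP => /= /andP[/eqP ii' ltj]; subst i'; apply: (T3 i j j' r r') => //.
    by rewrite has_entry_ord.
  by rewrite has_entry_ord.
- apply/forall_inP => -[[i j] r] tT; apply/forall_inP => -[[i' j'] r'] uT.
  apply/implyP => /= /andP[/eqP jj' lti]; subst j'; apply: (T4 i i' j r r') => //.
    by rewrite has_entry_ord.
  by rewrite has_entry_ord.
Qed.

(** Columns increase strictly. Hence [k] letters fill at most [k] rows, and the index [r.+1 + j - i]
    of an entry weight is never truncated. *)
Lemma svt_row_le (k : nat) (mu : nat -> nat) (T : {set triple}) (i j r : nat) :
  nonincr mu -> (forall i, mu i <= n)%N -> svt k mu T -> has_entry T i j r -> (i <= r)%N.
Proof.
move=> mu_dec mu_n /(svtP _ _ mu_n)[T1 T2 _ T4].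
elim: i r => [|i IHi] r ijr //; have [iltd _ _] := has_entry_lt ijr.
have [_ jmu] := T1 _ _ _ ijr.
have [r' ijr'] := T2 i j (ltnW iltd) (leq_trans jmu (mu_dec i)).
exact: leq_ltn_trans (IHi _ ijr') (T4 _ _ _ _ _ ijr' ijr (ltnSn i)).
Qed.
End Triples.

(** * Splitting a set-valued tableau at its largest letter *)

Section Branching.
Variables d n : nat.
Local Notation triple := ('I_d * 'I_n.+1 * 'I_d)%type.

Definition below (k : nat) (T : {set triple}) : {set triple} :=
  entries d n.+1 (fun i j r => has_entry T i j r && (r < k)%N).

(** A row ends at its first cell without a letter below [k]. If [find] fails it returns [n], still a
    valid length, so [inord] does no harm. *)
Definition below_shape (k : nat) (T : {set triple}) : {ffun 'I_k -> 'I_n.+1} :=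
  [ffun i : 'I_k => inord (find (fun j => ~~ [exists r : 'I_k, has_entry T i j r])
                             (iota 0 n))].

(** Rows of [rho] whose last cell also holds the letter [k]; nowhere else can [k] share a cell with
    smaller letters. *)
Definition corners (k : nat) (rho : nat -> nat) (T : {set triple}) : {set 'I_k} :=
  [set i : 'I_k | (0 < rho i)%N && has_entry T i (rho i).-1 k].

Definition top_strip (k : nat) (mu rho : nat -> nat) (C : {set 'I_k}) : {set triple} :=
  entries d n.+1 (fun i j r => (r == k) &&
    ((rho i <= j < mu i)%N || at_row C i && (j.+1 == rho i))).

Definition hstrip (k : nat) (mu rho : nat -> nat) : bool :=
  [forall i : 'I_k, (mu i.+1 <= rho i <= mu i)%N].

Variables (k : nat) (mu : nat -> nat).
Hypotheses (kd : (k < d)%N) (mu_dec : nonincr mu).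
Hypotheses (mu_k : mu k.+1 = 0%N) (mu_n : (mu 0 <= n)%N).

Let mu_le i : (mu i <= n)%N.
Proof. exact: leq_trans (nonincr_leq mu_dec (leq0n i)) mu_n. Qed.
Let mu_leS i : (mu i <= n.+1)%N.
Proof. exact: leqW (mu_le i). Qed.
Let mu_ge i : (k < i)%N -> mu i = 0%N.
Proof. by move=> ki; have := nonincr_leq mu_dec ki; rewrite mu_k leqn0 => /eqP. Qed.
Let ext_le (rho : {ffun 'I_k -> 'I_n.+1}) i : (extend rho i <= n.+1)%N.
Proof.
case: (ltnP i k) => ik; last by rewrite extend_ge.
by rewrite (extend_ord rho (Ordinal ik)) ltnW.
Qed.

Lemma has_below (T : {set triple}) (i j r : nat) :
  has_entry (below k T) i j r = has_entry T i j r && (r < k)%N.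
Proof.
rewrite has_entries; case: (boolP (has_entry T i j r)) => [/has_entry_lt[-> -> ->]|] //.
by rewrite !andbF.
Qed.

Lemma has_top_strip (rho : nat -> nat) (C : {set 'I_k}) (i j r : nat) :
  hstrip k mu rho -> (rho i <= n)%N ->
  has_entry (top_strip mu rho C) i j r
  = (r == k) && ((rho i <= j < mu i)%N || at_row C i && (j.+1 == rho i)).
Proof.
move=> strip rho_n; rewrite has_entries; apply/idP/idP => [/and4P[] //|H].
case/andP: (H) => /eqP-> /orP[/andP[_ jmu]|/andP[Ci /eqP jr]].
  rewrite kd (leq_trans jmu (mu_leS i)) eqxx.
  case: (ltnP i d) => id; last first.
    by rewrite mu_ge // in jmu; exact: leq_trans kd id.
  by move: H => /andP[_ ->].
have ik : (i < k)%N by rewrite ltnNge; apply/negP => /(at_row_ge C); rewrite Ci.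
by rewrite (ltn_trans ik kd) kd Ci jr !eqxx orbT !andbT /=; lia.
Qed.

Section Decompose.
Variable T : {set triple}.
Hypothesis T_svt : svt k.+1 mu T.
Local Notation rho := (extend (below_shape k T)).

Let T1 i j r : has_entry T i j r -> (r < k.+1)%N /\ (j < mu i)%N.
Proof. by have /(svtP _ _ mu_leS)[H _ _ _] := T_svt; exact: H. Qed.
Let T2 i j : (i < d)%N -> (j < mu i)%N -> exists r, has_entry T i j r.
Proof. by have /(svtP _ _ mu_leS)[_ H _ _] := T_svt; exact: H. Qed.
Let T3 i j j' r r' : has_entry T i j r -> has_entry T i j' r' -> (j < j')%N -> (r <= r')%N.
Proof. by have /(svtP _ _ mu_leS)[_ _ H _] := T_svt; exact: H. Qed.
Let T4 i i' j r r' : has_entry T i j r -> has_entry T i' j r' -> (i < i')%N -> (r < r')%N.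
Proof. by have /(svtP _ _ mu_leS)[_ _ _ H] := T_svt; exact: H. Qed.

(** Every cell is filled and rows increase weakly, so the cells with a letter below [k] form an
    initial segment of each row. *)
Lemma below_shapeP (i j : nat) :
  reflect (exists2 r, (r < k)%N & has_entry T i j r) (j < rho i)%N.
Proof.
case: (ltnP i k) => ik; last first.
  rewrite extend_ge //; apply: (iffP idP) => // -[r rk ijr].
  by have := svt_row_le mu_dec mu_leS T_svt ijr; lia.
rewrite (extend_ord _ (Ordinal ik)) ffunE /=.
set P := fun j => ~~ _; set m := find P _.
have m_n : (m <= n)%N by rewrite -[leqRHS](size_iota 0) find_size.
have smallP l : reflect (exists2 r, (r < k)%N & has_entry T i l r) (~~ P l).
  rewrite negbK; apply: (iffP existsP) => [[r]|[r rk]]; first by exists r.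
  by exists (Ordinal rk).
have small_le l l' : (l <= l')%N -> ~~ P l' -> ~~ P l.
  rewrite leq_eqVlt => /predU1P[->//|ll'] /smallP[r rk ijr].
  have [_ l'mu] := T1 ijr.
  have [r' ijr'] := T2 (ltn_trans ik kd) (ltn_trans ll' l'mu).
  by apply/smallP; exists r' => //; exact: leq_ltn_trans (T3 ijr' ijr ll') rk.
rewrite inordK ?ltnS //.
suff -> : (j < m)%N = ~~ P j by exact: smallP.
apply/idP/idP => [jm|Pj].
  have := before_find 0%N jm; rewrite nth_iota; last exact: leq_trans jm m_n.
  by rewrite add0n => ->.
rewrite ltnNge; apply/negP => mj.
have nPm := small_le _ _ mj Pj.
have m_n' : (m < n)%N.
  have [r _ ijr] := smallP _ nPm.
  by have [_ mmu] := T1 ijr; exact: leq_trans mmu (mu_le i).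
have : has P (iota 0 n) by rewrite has_find size_iota.
by move/(nth_find 0%N); rewrite -/m nth_iota // add0n (negbTE nPm).
Qed.

(** A cell with a cell of [mu] directly below it holds a letter smaller than some letter at most
    [k], so it lies in [rho]. *)
Lemma below_shape_hstrip : hstrip k mu rho.
Proof.
apply/forallP => i; apply/andP; split; rewrite leqNgt; apply/negP.
  move=> lt_mu; have [r ijr] := T2 (leq_ltn_trans (ltn_ord i) kd) lt_mu.
  have [r' ijr'] := T2 (ltn_trans (ltn_ord i) kd) (leq_trans lt_mu (mu_dec i)).
  suff : (rho i < rho i)%N by rewrite ltnn.
  apply/below_shapeP; exists r' => //.
  have := T4 ijr' ijr (ltnSn i); have [rk _] := T1 ijr; lia.
by case/below_shapeP => r _ /T1[_]; rewrite ltnn.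
Qed.

Lemma svt_below : svt k rho (below k T).
Proof.
apply/(svtP _ _ (ext_le _)); split.
- move=> i j r; rewrite has_below => /andP[ijr rk]; split=> //.
  by apply/below_shapeP; exists r.
- move=> i j id /below_shapeP[r rk ijr]; exists r.
  by rewrite has_below ijr.
- by move=> i j j' r r'; rewrite !has_below => /andP[h _] /andP[h' _]; exact: T3 h h'.
- by move=> i i' j r r'; rewrite !has_below => /andP[h _] /andP[h' _]; exact: T4 h h'.
Qed.

(** A cell of [mu] below a corner holding [k] would need a letter larger than [k]. *)
Lemma corners_ok : [forall i in corners k rho T, (mu i.+1 < rho i)%N].
Proof.
apply/forall_inP => i; rewrite inE => /andP[rho0 ijk].
rewrite ltnNge; apply/negP => rho_mu.
have lt_mu : ((rho i).-1 < mu i.+1)%N by lia.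
have [r ijr] := T2 (leq_ltn_trans (ltn_ord i) kd) lt_mu.
by have := T4 ijk ijr (ltnSn i); have [] := T1 ijr; lia.
Qed.

Lemma svt_decompose : T = below k T :|: top_strip mu rho (corners k rho T).
Proof.
apply: has_entry_inj => i j r; rewrite has_entryU has_below.
rewrite has_top_strip ?below_shape_hstrip //; last first.
  case: (ltnP i k) => ik; last by rewrite extend_ge.
  by rewrite (extend_ord _ (Ordinal ik)) -ltnS.
apply/idP/orP => [ijr|[/andP[] //|]]; last first.
  move=> /andP[/eqP-> /orP[/andP[rho_j jmu]|/andP[Ci /eqP jrho]]]; last first.
    have ik : (i < k)%N by rewrite ltnNge; apply/negP => /(at_row_ge (corners k rho T)); rewrite Ci.
    by move: Ci; rewrite (at_row_ord _ (Ordinal ik)) inE /= -jrho => /andP[_].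
  have id : (i < d)%N by case: (ltnP i d) => // id; move: jmu; rewrite mu_ge //; lia.
  have [r' ijr'] := T2 id jmu; have [r'k _] := T1 ijr'.
  suff -> : k = r' by [].
  case: (ltnP r' k) => [r'ltk|]; last by lia.
  suff : (j < rho i)%N by rewrite ltnNge rho_j.
  by apply/below_shapeP; exists r'.
have [rk jmu] := T1 ijr.
case: (ltnP r k) => r_k; [by left; rewrite ijr | right].
have {r_k rk} rE : r = k by lia.
subst r; rewrite eqxx jmu andbT /=; case: leqP => //= jrho.
have [r' r'k ijr'] := below_shapeP _ _ jrho.
have ik : (i < k)%N.
  by have := svt_row_le mu_dec mu_leS T_svt ijr'; move/leq_ltn_trans; apply.
(* A letter below [k] in the next cell would follow [k] in its row. *)
have jE : j.+1 = rho i.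
  apply/eqP; rewrite eqn_leq jrho leqNgt; apply/negP => j1rho.
  have [s sk ijs] := below_shapeP _ _ j1rho.
  by have := T3 ijr ijs (ltnSn j); lia.
by rewrite jE eqxx andbT (at_row_ord _ (Ordinal ik)) inE /= -jE.
Qed.
End Decompose.

Section Compose.
Variables (rho : {ffun 'I_k -> 'I_n.+1}) (T' : {set triple}) (C : {set 'I_k}).
Hypothesis strip : hstrip k mu (extend rho).
Hypothesis T'_svt : svt k (extend rho) T'.
Hypothesis C_ok : [forall i in C, (mu i.+1 < extend rho i)%N].
Local Notation rho' := (extend rho).
Local Notation T := (T' :|: top_strip mu rho' C).

Let rho_le i : (rho' i <= n)%N.
Proof.
case: (ltnP i k) => ik; last by rewrite extend_ge.
by rewrite (extend_ord rho (Ordinal ik)) -ltnS.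
Qed.
Let at_rowC i : at_row C i -> (i < k)%N /\ (mu i.+1 < rho' i)%N.
Proof.
move=> Ci; have ik : (i < k)%N.
  by rewrite ltnNge; apply/negP => /(at_row_ge C); rewrite Ci.
split=> //; move: Ci; rewrite (at_row_ord C (Ordinal ik)) => Ci.
by have /forall_inP/(_ _ Ci) := C_ok.
Qed.
Let rho_mu i : (rho' i <= mu i)%N.
Proof.
case: (ltnP i k) => ik; last by rewrite extend_ge.
by have /forallP/(_ (Ordinal ik))/andP[] := strip.
Qed.
Let mu_rho i : (mu i.+1 <= rho' i)%N.
Proof.
case: (ltnP i k) => ik; last by rewrite extend_ge // mu_ge.
by have /forallP/(_ (Ordinal ik))/andP[] := strip.
Qed.
Let has_T i j r : has_entry T i j r = has_entry T' i j r ||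
  (r == k) && ((rho' i <= j < mu i)%N || at_row C i && (j.+1 == rho' i)).
Proof. by rewrite has_entryU has_top_strip. Qed.
Let T1 i j r : has_entry T' i j r -> (r < k)%N /\ (j < rho' i)%N.
Proof. by have /(svtP _ _ (ext_le _))[H _ _ _] := T'_svt; exact: H. Qed.
Let T2 i j : (i < d)%N -> (j < rho' i)%N -> exists r, has_entry T' i j r.
Proof. by have /(svtP _ _ (ext_le _))[_ H _ _] := T'_svt; exact: H. Qed.
Let T3 i j j' r r' : has_entry T' i j r -> has_entry T' i j' r' -> (j < j')%N -> (r <= r')%N.
Proof. by have /(svtP _ _ (ext_le _))[_ _ H _] := T'_svt; exact: H. Qed.
Let T4 i i' j r r' : has_entry T' i j r -> has_entry T' i' j r' -> (i < i')%N -> (r < r')%N.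
Proof. by have /(svtP _ _ (ext_le _))[_ _ _ H] := T'_svt; exact: H. Qed.

(** The delicate point is column strictness: a cell with a cell of [mu] below it lies in [rho] by
    interlacing and is not one of the corners allowed by [C_ok], so it does not receive [k]. *)
Lemma svt_compose : svt k.+1 mu T.
Proof.
apply/(svtP _ _ mu_leS); split.
- move=> i j r; rewrite has_T => /orP[/T1[rk jrho]|].
    by split; [lia | exact: leq_trans jrho (rho_mu i)].
  move=> /andP[/eqP-> /orP[/andP[_ jmu] //|/andP[_ /eqP jE]]].
  by split=> //; rewrite jE.
- move=> i j id jmu; case: (ltnP j (rho' i)) => jrho.
    by have [r ijr] := T2 id jrho; exists r; rewrite has_T ijr.
  by exists k; rewrite has_T eqxx jrho jmu orbT.
- move=> i j j' r r'; rewrite !has_T.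
  case/orP=> [h|/andP[/eqP-> h]] /orP[h'|/andP[/eqP-> h']] ltj //.
  + exact: T3 h h' ltj.
  + by have [] := T1 h; lia.
  + have [_ j'rho] := T1 h'; case/orP: h => [/andP[rhoj _]|/andP[_ /eqP jE]]; lia.
- move=> i i' j r r'; rewrite !has_T => h h' lti.
  have jmu' : (j < mu i.+1)%N -> (rho' i <= j)%N -> False.
    by have := mu_rho i; lia.
  have jmu : (j < mu i.+1)%N.
    apply: leq_trans (nonincr_leq mu_dec lti).
    case/orP: h' => [/T1[_ /leq_trans]|/andP[_ /orP[/andP[] //|/andP[_ /eqP->]]]]; last exact: rho_mu.
    by apply; exact: rho_mu.
  case/orP: h => [h|/andP[_ /orP[/andP[h _]|/andP[/at_rowC[_ h] /eqP jE]]]].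
  + case/orP: h' => [h'|/andP[/eqP-> _]]; first exact: T4 h h' lti.
    by have [] := T1 h.
  + by case: (jmu' jmu h).
  + by move: h; rewrite -jE; lia.
Qed.

Lemma below_compose : below k T = T'.
Proof.
apply: has_entry_inj => i j r; rewrite has_below has_T.
case: (boolP (has_entry T' i j r)) => [/T1[->] //|_] /=.
by case: eqP => //= ->; rewrite ltnn andbF.
Qed.

Lemma below_shape_compose : below_shape k T = rho.
Proof.
apply: extend_inj => i ik.
have E j : (j < extend (below_shape k T) i)%N = (j < rho' i)%N.
  apply/(below_shapeP svt_compose)/idP => [[r rk]|jrho].
    by rewrite has_T => /orP[/T1[] //|/andP[/eqP rE]]; rewrite rE ltnn in rk.
  have [r ijr] := T2 (ltn_trans ik kd) jrho; have [rk _] := T1 ijr.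
  by exists r; rewrite // has_T ijr.
have := E (extend (below_shape k T) i); have := E (rho' i); rewrite !ltnn.
by case: ltngtP.
Qed.

Lemma corners_compose : corners k rho' T = C.
Proof.
apply/setP => i; rewrite inE has_T eqxx /= at_row_ord.
apply/andP/idP => [[rho0]|iC].
  case/orP => [/T1[]|]; first by rewrite ltnn.
  by case/orP => [|/andP[] //]; lia.
have /forall_inP/(_ _ iC) ? := C_ok; split; first by lia.
by rewrite iC prednK ?eqxx ?orbT //; lia.
Qed.
End Compose.
End Branching.

(** * The branching rule for the sums over tableaux *)

Section BranchingSum.
Variables (R : fieldType) (X A : nat -> R).

Definition entry_wt (r i j : nat) : R := X r * A (r.+1 + j - i)%N - 1.
Definition svt_sum (d n k : nat) (mu : nat -> nat) : R :=
  \sum_(T : {set 'I_d * 'I_n * 'I_d} | svt k mu T)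
     \prod_(t in T) entry_wt t.2 t.1.1 t.1.2.

Lemma prod_triples (d n : nat) (P : nat -> nat -> nat -> bool) (F : nat -> nat -> nat -> R) :
  \prod_(t in entries d n P) F t.1.1 t.1.2 t.2
  = \prod_(i < d) \prod_(j < n) \prod_(r < d | P i j r) F i j r.
Proof.
rewrite pair_big /= pair_big_dep /=.
by apply: eq_bigl => -[[i j] r]; rewrite inE.
Qed.

Lemma prod_ord_wide (m n : nat) (F : nat -> R) :
  (m <= n)%N -> (forall i, (m <= i)%N -> F i = 1) ->
  \prod_(i < n) F i = \prod_(i < m) F i.
Proof.
move=> mn F1; rewrite (big_ord_widen n F mn) [RHS]big_mkcond /=.
by apply: eq_bigr => i _; case: ltnP => // /F1.
Qed.

Lemma prod_top_strip (d n k : nat) (mu rho : nat -> nat) (C : {set 'I_k}) :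
  (k < d)%N -> (forall i, mu i <= n)%N -> (forall i, (k < i)%N -> mu i = 0%N) ->
  (forall i, rho i <= n)%N -> [forall i in C, (mu i.+1 < rho i)%N] ->
  \prod_(t in top_strip d n mu rho C) entry_wt t.2 t.1.1 t.1.2
  = \prod_(i < k.+1) \prod_(rho i <= j < mu i) entry_wt k i j
    * \prod_(i < k) (if i \in C then entry_wt k i (rho i).-1 else 1).
Proof.
move=> kd mu_n mu_k rho_n C_ok.
have at_rowC i : at_row C i -> (i < k)%N /\ (0 < rho i)%N.
  move=> Ci; have ik : (i < k)%N.
    by rewrite ltnNge; apply/negP => /(at_row_ge C); rewrite Ci.
  split=> //; move: Ci; rewrite (at_row_ord C (Ordinal ik)) => Ci.
  by have /forall_inP/(_ _ Ci) := C_ok; exact: leq_ltn_trans.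
rewrite /top_strip (prod_triples _ _ _ (fun i j r => entry_wt r i j)).
transitivity (\prod_(i < d) (\prod_(rho i <= j < mu i) entry_wt k i j
    * (if at_row C i then entry_wt k i (rho i).-1 else 1))); last first.
  rewrite big_split /=; congr (_ * _).
    rewrite (prod_ord_wide (F := fun i => \prod_(rho i <= j < mu i) entry_wt k i j) kd) //.
    by move=> i ki; rewrite mu_k // big_geq.
  rewrite (prod_ord_wide (F := fun i => if at_row C i then entry_wt k i (rho i).-1 else 1) (ltnW kd)).
    by apply: eq_bigr => i _; rewrite at_row_ord.
  by move=> i ki; rewrite at_row_ge.
apply: eq_bigr => i _.
transitivity (\prod_(j < n.+1) ((if (rho i <= j < mu i)%N then entry_wt k i j else 1)
   * (if at_row C i && (j.+1 == rho i) then entry_wt k i j else 1))).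
  apply: eq_bigr => j _.
  case: (boolP (rho i <= j < mu i)%N) => /= h1; last first.
    rewrite mul1r; case: ifP => h2; last by rewrite big1 // => r; rewrite andbF.
    rewrite (eq_bigl (pred1 (Ordinal kd))) ?big_pred1_eq // => r.
    by rewrite andbT /= -val_eqE.
  rewrite (eq_bigl (pred1 (Ordinal kd))) ?big_pred1_eq //= => [|r]; last first.
    by rewrite andbT /= -val_eqE.
  case: ifP => [/andP[_ /eqP jE]|_]; last by rewrite mulr1.
  by move: h1; rewrite -jE ltnn.
rewrite big_split /= -!big_mkcond /=; congr (_ * _).
  rewrite (big_nat_widen _ _ n.+1) ?leqW // (big_nat_widenl _ 0) // big_mkord.
  by apply: eq_bigl => j; rewrite andbC.
case: ifP => [/at_rowC[_ rho0]|_]; last by rewrite big1.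
have jn : ((rho i).-1 < n.+1)%N by have := rho_n i; lia.
rewrite (eq_bigl (pred1 (Ordinal jn))) ?big_pred1_eq // => j.
by rewrite /= -val_eqE /= -[in LHS](prednK rho0) eqSS.
Qed.

(** With these beta-sets the strip cells of row [i] have indices strictly between [b_i] and [a_i],
    and the corner of [rho] has index [b_i]. Interlacing becomes [a_(i+1) <= b_i < a_i], and a
    factor is 0 when it fails. *)
Lemma transfer_shape (k : nat) (mu rho : nat -> nat) :
  nonincr mu -> rho k = 0%N ->
  transfer (X k) A k (fun i => mu i + k.+1 - i)%N (fun i => rho i + k - i)%N
  = if hstrip k mu rho then
      \prod_(i < k.+1) \prod_(rho i <= j < mu i) entry_wt k i j
      * \prod_(i < k) (if (mu i.+1 < rho i)%N then 1 + entry_wt k i (rho i).-1 else 1)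
    else 0.
Proof.
move=> mu_dec rho_k; rewrite /transfer; case: ifPn => [/forallP strip|].
  congr (_ * _).
    apply: eq_bigr => i _; have ik := ltn_ord i.
    have rho_mu : (rho i <= mu i)%N.
      case: (ltnP i k) => ik'; first by have /andP[] := strip (Ordinal ik').
      have -> : i = k :> nat by lia.
      by rewrite rho_k.
    rewrite /row_wt ifT /gap_wt; last by lia.
    have -> : (rho i + k - i).+1 = (rho i + (k.+1 - i))%N by lia.
    rewrite big_addn; have -> : (mu i + k.+1 - i - (k.+1 - i) = mu i)%N by lia.
    apply: eq_bigr => j _; rewrite /entry_wt; congr (_ * A _ - _); lia.
  apply: eq_bigr => i _; have ik := ltn_ord i; have /andP[lt1 _] := strip i.
  rewrite /link_wt; case: ifP => h1.
    rewrite ifT; last by lia.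
    rewrite /entry_wt addrC subrK; congr (_ * A _); lia.
  rewrite ifT; last by lia.
  by rewrite ifF //; lia.
case/forallPn => i /nandP[] h; have ik := ltn_ord i.
  rewrite [X in _ * X](bigD1 i) //= /link_wt ifF; last by lia.
  by rewrite ifF ?mul0r ?mulr0 //; lia.
by rewrite (bigD1 (widen_ord (leqnSn k) i)) //= /row_wt ifF ?mul0r //; lia.
Qed.

Lemma svt_sum_branch (d n k : nat) (mu : nat -> nat) :
  (k < d)%N -> nonincr mu -> mu k.+1 = 0%N -> (mu 0 <= n)%N ->
  svt_sum d n.+1 k.+1 mu
  = \sum_(rho : {ffun 'I_k -> 'I_n.+1})
      transfer (X k) A k (fun i => mu i + k.+1 - i)%N (fun i => extend rho i + k - i)%N
      * svt_sum d n.+1 k (extend rho).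
Proof.
move=> kd mu_dec mu_k mu_n.
have mu_le i : (mu i <= n)%N by exact: leq_trans (nonincr_leq mu_dec (leq0n i)) mu_n.
have mu_ge i : (k < i)%N -> mu i = 0%N.
  by move=> ki; have := nonincr_leq mu_dec ki; rewrite mu_k leqn0 => /eqP.
rewrite /svt_sum (partition_big (@below_shape d n k) predT) //=.
apply: eq_bigr => rho _; rewrite transfer_shape ?extend_ge //.
case: ifPn => [strip|nstrip]; last first.
  rewrite mul0r big_pred0 // => T; apply: contraNF nstrip => /andP[Tsvt /eqP <-].
  exact: below_shape_hstrip.
have rho_le i : (extend rho i <= n)%N.
  case: (ltnP i k) => ik; last by rewrite extend_ge.
  by rewrite (extend_ord rho (Ordinal ik)) -ltnS.
pose compose (p : {set 'I_d * 'I_n.+1 * 'I_d} * {set 'I_k}) :=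
  p.1 :|: top_strip d n mu (extend rho) p.2.
pose split T := (below k T, corners k (extend rho) T) : {set 'I_d * 'I_n.+1 * 'I_d} * {set 'I_k}.
rewrite (reindex_onto compose split) => [|T /andP[Tsvt /eqP rhoE]]; last first.
  by rewrite /compose /split /= -rhoE -svt_decompose.
have E p : ((svt k.+1 mu (compose p) && (below_shape k (compose p) == rho))
    && (split (compose p) == p))
  = svt k (extend rho) p.1 && [forall i in p.2, (mu i.+1 < extend rho i)%N].
  case: p => T' C; apply/idP/idP => [/andP[/andP[Tsvt /eqP sh] /eqP[TE CE]]|/andP[T'svt Cok]] /=.
    have := svt_below kd mu_dec mu_k mu_n Tsvt.
    have := corners_ok kd mu_dec mu_k mu_n Tsvt.
    by rewrite sh TE CE => -> ->.
  rewrite /compose /= svt_compose //= below_shape_compose // eqxx /=.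
  by rewrite /split below_compose // corners_compose.
rewrite (eq_bigl _ _ E).
transitivity (\sum_(p : {set 'I_d * 'I_n.+1 * 'I_d} * {set 'I_k} |
    svt k (extend rho) p.1 && [forall i in p.2, (mu i.+1 < extend rho i)%N])
  (\prod_(t in p.1) entry_wt t.2 t.1.1 t.1.2) *
  (\prod_(i < k.+1) \prod_(extend rho i <= j < mu i) entry_wt k i j
    * \prod_(i < k) (if i \in p.2 then entry_wt k i (extend rho i).-1 else 1))).
  apply: eq_bigr => -[T' C] /= /andP[T'svt Cok].
  rewrite -(prod_top_strip kd mu_le) // /compose /=.
  rewrite -bigU /=; last first.
    apply/pred0P => -[[i j] r] /=; apply/negP => /andP[tT'].
    rewrite inE /= => /andP[/eqP rk _].
    have /(svtP _ _ (fun i => leqW (rho_le i)))[T1 _ _ _] := T'svt.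
    by have [] := T1 i j r; rewrite ?has_entry_ord // rk ltnn.
  by apply: eq_bigl => t; rewrite inE.
rewrite -(pair_big_dep (svt k (extend rho)) (fun _ (C : {set 'I_k}) => [forall i in C, (mu i.+1 < extend rho i)%N])
  (fun (T : {set 'I_d * 'I_n.+1 * 'I_d}) (C : {set 'I_k}) => (\prod_(t in T) entry_wt t.2 t.1.1 t.1.2) *
   (\prod_(i < k.+1) \prod_(extend rho i <= j < mu i) entry_wt k i j
    * \prod_(i < k) (if i \in C then entry_wt k i (extend rho i).-1 else 1)))) /=.
rewrite mulr_sumr; apply: eq_bigr => T' _.
rewrite -!mulr_sumr mulrC; congr (_ * _ * _).
(* Summing over the corners gives [1 + entry_wt] for each admissible one, as in [transfer_shape]. *)
rewrite (sum_subsets_prod (fun i : 'I_k => (mu i.+1 < extend rho i)%N)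
  (fun i b => if b then entry_wt k i (extend rho i).-1 else 1)).
by apply: eq_bigr => i _; case: ifP => _; rewrite ?addr0.
Qed.
End BranchingSum.

(** * The Pieri rule *)

Lemma eq_transfer (R : fieldType) (x : R) (A : nat -> R) (k : nat) (a a' b b' : nat -> nat) :
  (forall i, (i <= k)%N -> a i = a' i) -> (forall i, (i <= k)%N -> b i = b' i) ->
  transfer x A k a b = transfer x A k a' b'.
Proof.
move=> aE bE; rewrite /transfer; congr (_ * _); apply: eq_bigr => i _.
  by rewrite aE ?bE // -ltnS.
by rewrite aE ?bE // ltnW.
Qed.

Lemma eq_svt_sum (R : fieldType) (X A : nat -> R) (d n k : nat) (mu nu : nat -> nat) :
  (forall i, mu i = nu i) -> svt_sum X A d n k mu = svt_sum X A d n k nu.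
Proof.
move=> mu_nu; apply: eq_bigl => T; rewrite /svt; congr [&& _, _, _ & _].
  by apply: eq_forallb => t; rewrite mu_nu.
by apply: eq_forallb => i; apply: eq_forallb => j; rewrite mu_nu.
Qed.

Definition addable (k : nat) (mu : nat -> nat) (e : {set 'I_k}) : bool :=
  [forall i in e, (i == 0%N :> nat) || (mu i < mu i.-1)%N].

Lemma at_row_lt (k : nat) (e : {set 'I_k}) (i : nat) : at_row e i -> (i < k)%N.
Proof. by rewrite ltnNge; apply: contraTN => /(at_row_ge e) ->. Qed.

Lemma at_rowP (k : nat) (e : {set 'I_k}) (P : nat -> bool) :
  reflect (forall i, at_row e i -> P i) [forall i in e, P i].
Proof.
apply: (iffP forall_inP) => [Pe i ei|Pe i ie]; last by apply: Pe; rewrite at_row_ord.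
have ik := at_row_lt ei; apply: (Pe (Ordinal ik)).
by rewrite -at_row_ord.
Qed.

Lemma addable_raise (k : nat) (mu : nat -> nat) (e : {set 'I_k}) :
  nonincr mu -> addable mu e -> nonincr (raise mu e).
Proof.
move=> mu_dec /(at_rowP e (fun i => (i == 0%N) || (mu i < mu i.-1)%N)) ok i.
rewrite /raise; have := mu_dec i; have := ok i.+1; rewrite /=.
by case: (at_row e i.+1) => [/(_ isT)|_]; case: (at_row e i); lia.
Qed.

Section Pieri.
Variables (R : fieldType) (X A : nat -> R) (d n : nat).
Hypotheses (X_neq0 : forall r, X r != 0) (A_neq0 : forall c, A c != 0).
Local Notation S := (svt_sum X A d n.+1).
Local Notation shape k := {ffun 'I_k -> 'I_n.+1}.

Definition raise_shape k (rho : shape k) (e : {set 'I_k}) : shape k :=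
  [ffun i : 'I_k => inord (raise (extend rho) e i)].
Definition lower_shape k (rho : shape k) (e : {set 'I_k}) : shape k :=
  [ffun i : 'I_k => inord (lower (extend rho) e i)].

Lemma extend_raise k (rho : shape k) (e : {set 'I_k}) (i : nat) :
  (raise (extend rho) e i <= n)%N -> extend (raise_shape rho e) i = raise (extend rho) e i.
Proof.
case: (ltnP i k) => ik; last by rewrite /raise at_row_ge // !extend_ge.
by move=> le_n; rewrite (extend_ord _ (Ordinal ik)) ffunE inordK.
Qed.

Lemma extend_le k (rho : shape k) (i : nat) : (extend rho i <= n)%N.
Proof.
case: (ltnP i k) => ik; last by rewrite extend_ge.
by rewrite (extend_ord rho (Ordinal ik)) -ltnS.
Qed.

Lemma extend_lower k (rho : shape k) (e : {set 'I_k}) (i : nat) :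
  extend (lower_shape rho e) i = lower (extend rho) e i.
Proof.
case: (ltnP i k) => ik; last by rewrite /lower at_row_ge // !extend_ge.
rewrite (extend_ord _ (Ordinal ik)) ffunE inordK // ltnS.
exact: leq_trans (leq_subr _ _) (extend_le _ _).
Qed.

Definition beta_set (k : nat) (rho : nat -> nat) (i : nat) : nat := rho i + k - i.

Definition removable k (rho : nat -> nat) (e : {set 'I_k}) : bool :=
  [forall i in e, (rho i.+1 < rho i)%N].
Definition decreasing_upto k (rho : nat -> nat) : bool :=
  [forall i : 'I_k, (rho i.+1 <= rho i)%N].

Lemma hstripP k (mu rho : nat -> nat) :
  reflect (forall i, (i < k)%N -> (mu i.+1 <= rho i)%N /\ (rho i <= mu i)%N) (hstrip k mu rho).
Proof.
apply: (iffP forallP) => [H i ik|H i]; last by apply/andP/H.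
by apply/andP/(H (Ordinal ik)).
Qed.

(** Double counting of the pairs in which [rho] is [kap] with corners [e] added: [e] is removable
    from [rho] exactly when it is addable to [kap]. The bound [mu 0 < n] leaves room for the raised
    shape. *)
Lemma sum_raise_lower (k : nat) (mu : nat -> nat) (F : shape k -> shape k -> R) :
  nonincr mu -> (mu 0 < n)%N ->
  \sum_(rho : shape k | decreasing_upto k (extend rho))
     \sum_(e : {set 'I_k} | removable (extend rho) e && hstrip k mu (extend (lower_shape rho e)))
        F (lower_shape rho e) rho
  = \sum_(kap : shape k | hstrip k mu (extend kap))
     \sum_(e : {set 'I_k} | addable (extend kap) e) F kap (raise_shape kap e).
Proof.
move=> mu_dec mu_n; rewrite !pair_big_dep /=.
pose up (p : shape k * {set 'I_k}) := (raise_shape p.1 p.2, p.2).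
pose down (p : shape k * {set 'I_k}) := (lower_shape p.1 p.2, p.2).
rewrite (reindex_onto up down) => [|[rho e] /and3P[_ /= rem _]]; last first.
  have {rem}rem := at_rowP e (fun i => (extend rho i.+1 < extend rho i)%N) rem.
  rewrite /up /down /=; congr (_, _); apply: extend_inj => i ik.
  have E : raise (extend (lower_shape rho e)) e i = extend rho i.
    rewrite /raise extend_lower /lower; have := rem i.
    by case: (at_row e i) => [/(_ isT)|_]; lia.
  by rewrite extend_raise E // extend_le.
suff condE (kap : shape k) (e : {set 'I_k}) :
    [&& decreasing_upto k (extend (raise_shape kap e)),
        removable (extend (raise_shape kap e)) e
      & hstrip k mu (extend (lower_shape (raise_shape kap e) e))]
    && (down (up (kap, e)) == (kap, e))
    = hstrip k mu (extend kap) && addable (extend kap) e.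
  apply: eq_big => [[kap e]|[kap e] /andP[_ /eqP[H]]] /=; last by rewrite H.
  exact: condE.
apply/andP/andP => [[/and3P[/forallP dec rem strip] /eqP[kapE]]|[strip add]].
  rewrite kapE in strip; split=> //.
  have {rem}rem := at_rowP e (fun i => (extend _ i.+1 < extend _ i)%N) rem.
  apply/(at_rowP e (fun i => (i == 0%N) || (extend kap i < extend kap i.-1)%N)) => i ei.
  case: i ei => [|i] ei //=; have ik := at_row_lt ei.
  rewrite -kapE !extend_lower /lower ei.
  have := rem _ ei; have := dec (Ordinal (ltnW ik)) => /=; have := rem i.
  by case: (at_row e i) => [/(_ isT)|_]; lia.
have stripP := hstripP _ _ _ strip.
have addP := at_rowP e (fun i => (i == 0%N) || (extend kap i < extend kap i.-1)%N) add.
have kap_mu i : (extend kap i <= mu i)%N.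
  by case: (ltnP i k) => [/stripP[_ ->]|ik] //; rewrite extend_ge.
have kap_dec i : (extend kap i.+1 <= extend kap i)%N.
  case: (ltnP i k) => [/stripP[+ _]|ik]; last by rewrite extend_ge ?leqW.
  by apply: leq_trans; exact: kap_mu.
have upE i : extend (raise_shape kap e) i = raise (extend kap) e i.
  apply: extend_raise; apply: (@leq_trans (mu 0%N).+1) => //.
  have := nonincr_leq mu_dec (leq0n i); have := kap_mu i.
  by rewrite /raise; case: (at_row e i); lia.
have E : lower_shape (raise_shape kap e) e = kap.
  apply: extend_inj => i _; rewrite extend_lower /lower upE /raise; lia.
rewrite E strip; split; last by rewrite /down /up /= E.
apply/and3P; split=> //.
  apply/forallP => i; rewrite !upE /raise; have := kap_dec i; have := addP i.+1.
  by rewrite /=; case: (at_row e i.+1) => [/(_ isT)|_]; case: (at_row e i); lia.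
apply/(at_rowP e (fun i => (extend _ i.+1 < extend _ i)%N)) => i ei.
rewrite !upE /raise ei; have := kap_dec i; have := addP i.+1.
by rewrite /=; case: (at_row e i.+1) => [/(_ isT)|_]; lia.
Qed.

Lemma svt_sum_pieri (k : nat) (mu : nat -> nat) :
  (k <= d)%N -> nonincr mu -> mu k = 0%N -> (mu 0 < n)%N ->
  \sum_(e : {set 'I_k} | addable mu e) S k (raise mu e)
  = \prod_(r < k) X r * \prod_(i < k) A (beta_set k mu i) * S k mu.
Proof.
elim: k mu => [|k IHk] mu kd mu_dec mu_k mu_n.
  rewrite !big_ord0 !mul1r (big_pred1 set0) => [|e].
    by apply: eq_svt_sum => i; rewrite /raise at_row_ge ?addn0.
  rewrite /= (_ : e = set0) ?eqxx; last by apply/setP => -[].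
  by apply/forall_inP => i; rewrite inE.
pose a := beta_set k.+1 mu.
have rho_k (rho : shape k) : extend rho k = 0%N by rewrite extend_ge.
(* Branch each raised shape and exchange the sums; a [rho] that is not decreasing interlaces with no
   partition. *)
transitivity (\sum_(rho : shape k | decreasing_upto k (extend rho))
   (\sum_(e : {set 'I_k.+1} | addable mu e)
      transfer (X k) A k (raise a e) (beta_set k (extend rho))) * S k (extend rho)).
  transitivity (\sum_(e : {set 'I_k.+1} | addable mu e) \sum_(rho : shape k)
      transfer (X k) A k (beta_set k.+1 (raise mu e)) (beta_set k (extend rho))
      * S k (extend rho)).
    apply: eq_bigr => e add; apply: svt_sum_branch => //.
    - exact: addable_raise.
    - by rewrite /raise at_row_ge // mu_k.
    - by rewrite /raise; case: (at_row e 0%N); lia.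
  rewrite exchange_big /= [RHS]big_mkcond; apply: eq_bigr => rho _.
  rewrite -mulr_suml; case: ifPn => [_|ndec].
    congr (_ * _); apply: eq_bigr => e _; apply: eq_transfer => // i ik.
    by rewrite /a /beta_set /raise; lia.
  rewrite big1 ?mul0r // => e add; rewrite transfer_shape //; last exact: addable_raise.
  case: ifPn => // /hstripP strip; case/forallPn: ndec => i /negP[].
  have [le1 _] := strip i (ltn_ord i).
  case: (ltnP i.+1 k) => ik; last by rewrite extend_ge.
  by have [_ le2] := strip _ ik; exact: leq_trans le2 le1.
(* Corners added to [mu] are traded for corners removed from [rho]. Requiring the lowered shape to
   interlace with [mu] discards only zero terms. *)
transitivity (X k * \prod_(i < k.+1) A (a i) *
  \sum_(rho : shape k | decreasing_upto k (extend rho))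
    \sum_(e : {set 'I_k} | removable (extend rho) e && hstrip k mu (extend (lower_shape rho e)))
      transfer (X k) A k a (beta_set k (extend (lower_shape rho e)))
      / \prod_(i < k) A (beta_set k (extend (lower_shape rho e)) i) * S k (extend rho)).
  rewrite mulr_sumr; apply: eq_bigr => rho /forallP dec.
  have -> : \sum_(e : {set 'I_k.+1} | addable mu e)
      transfer (X k) A k (raise a e) (beta_set k (extend rho))
    = X k * \prod_(i < k.+1) A (a i) *
      \sum_(e : {set 'I_k} | [forall i in e,
           (beta_set k (extend rho) i.+1 < (beta_set k (extend rho) i).-1)%N])
        (transfer (X k) A k a (lower (beta_set k (extend rho)) e)
          / \prod_(i < k) A (lower (beta_set k (extend rho)) e i)).
    rewrite -transfer_exchange //.
    - apply: eq_bigl => e; apply: eq_forallb => i; congr (_ ==> _).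
      have := ltn_ord i; rewrite /a /beta_set; case: (i : nat) => [|j] //= jk; lia.
    - by move=> i ik; rewrite /a /beta_set; have := mu_dec i; lia.
    - by move=> i ik; rewrite /beta_set; have := dec (Ordinal ik); rewrite /=; lia.
    - by rewrite /a /beta_set; lia.
    - by rewrite /beta_set rho_k; lia.
  rewrite -mulrA; congr (_ * _); rewrite mulr_suml.
  have remE (e : {set 'I_k}) : [forall i in e,
        (beta_set k (extend rho) i.+1 < (beta_set k (extend rho) i).-1)%N]
      = removable (extend rho) e.
    apply: eq_forallb => i; congr (_ ==> _).
    by have := ltn_ord i; rewrite /beta_set; lia.
  rewrite (eq_bigl _ _ remE) big_mkcondr /=; apply: eq_bigr => e rem.
  have {rem}rem := at_rowP e (fun i => (extend rho i.+1 < extend rho i)%N) rem.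
  have lowE i : (i <= k)%N -> lower (beta_set k (extend rho)) e i
      = beta_set k (extend (lower_shape rho e)) i.
    rewrite /beta_set extend_lower /lower => ik; have := rem i.
    by case: (at_row e i) => [/(_ isT)|_]; lia.
  rewrite (eq_transfer _ _ (fun i _ => erefl) lowE).
  have -> : \prod_(i < k) A (lower (beta_set k (extend rho)) e i)
      = \prod_(i < k) A (beta_set k (extend (lower_shape rho e)) i).
    by apply: eq_bigr => i _; rewrite lowE // ltnW.
  case: ifPn => // nstrip.
  by rewrite transfer_shape // (negbTE nstrip) !mul0r.
(* For fixed [kap] the inner sum is now that of the induction hypothesis, and branching [S k.+1 mu]
   gives the same outer sum. *)
rewrite (sum_raise_lower (fun kap rho => transfer (X k) A k a (beta_set k (extend kap))
  / \prod_(i < k) A (beta_set k (extend kap) i) * S k (extend rho)) mu_dec mu_n).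
rewrite svt_sum_branch //; last exact: ltnW.
rewrite [\prod_(r < k.+1) X r]big_ord_recr /=.
transitivity (X k * \prod_(i < k.+1) A (a i) * \sum_(kap : shape k)
   \prod_(r < k) X r * (transfer (X k) A k a (beta_set k (extend kap)) * S k (extend kap))).
  congr (_ * _); rewrite big_mkcond /=; apply: eq_bigr => kap _.
  case: ifPn => [strip|nstrip]; last by rewrite transfer_shape // (negbTE nstrip) mul0r mulr0.
  have kap_mu i : (extend kap i <= mu i)%N.
    case: (ltnP i k) => ik; last by rewrite extend_ge.
    by have [] := hstripP _ _ _ strip i ik.
  have kap_dec : nonincr (extend kap).
    move=> i; case: (ltnP i k) => ik; last by rewrite extend_ge ?leqW.
    have [le1 _] := hstripP _ _ _ strip i ik.
    exact: leq_trans (kap_mu _) le1.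
  have kap_n : (extend kap 0 < n)%N by exact: leq_ltn_trans (kap_mu 0%N) mu_n.
  have raiseE : \sum_(e : {set 'I_k} | addable (extend kap) e) S k (extend (raise_shape kap e))
      = \sum_(e : {set 'I_k} | addable (extend kap) e) S k (raise (extend kap) e).
    apply: eq_bigr => e _; apply: eq_svt_sum => i; apply: extend_raise.
    have := nonincr_leq kap_dec (leq0n i).
    by rewrite /raise; case: (at_row e i); lia.
  rewrite -mulr_sumr raiseE IHk //; last exact: ltnW.
  have D0 : \prod_(i < k) A (beta_set k (extend kap) i) != 0.
    by apply/prodf_neq0 => i _; exact: A_neq0.
  by field.
by rewrite -mulr_sumr; ring.
Qed.
End Pieri.

(** * Specialization at a partition *)

Section Specialization.
Variables (R : fieldType) (beta : R) (d n : nat) (lam lam' : nat -> nat).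
Hypothesis beta_unit : forall m : nat, 1 + beta * m%:R != 0.
Definition specX (r : nat) : R := (1 + beta * (lam (d.-1 - r) + r.+1)%:R)^-1.
Definition specA (c : nat) : R := 1 + beta * c%:R.
Local Notation S := (svt_sum specX specA d n.+1).
Local Notation wt := (entry_wt specX specA).

Lemma entry_wt_spec (r i j : nat) : (i <= r)%N ->
  wt r i j = - beta * ((lam (d.-1 - r))%:R + i%:R - j%:R)
             / (1 + beta * (lam (d.-1 - r) + r.+1)%:R).
Proof.
move=> ir; rewrite /entry_wt /specX /specA.
have -> : (lam (d.-1 - r))%:R = (lam (d.-1 - r) + r.+1)%:R - r.+1%:R :> R.
  by rewrite natrD addrK.
have -> : (r.+1 + j - i)%:R = r.+1%:R + j%:R - i%:R :> R.
  by rewrite natrB ?natrD //; lia.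
move: (beta_unit (lam (d.-1 - r) + r.+1)); move: (_ + _)%:R (r.+1%:R) => y s nz.
by field.
Qed.

Hypotheses (lam_dec : nonincr lam) (lam_d : lam d = 0%N) (lam_n : (lam 0%N <= n)%N).
Hypothesis lam'E : forall i j, (i < lam' j)%N = (j < lam i)%N.

Section Nonvanishing.
Variables (nu : nat -> nat) (T : {set 'I_d * 'I_n.+1 * 'I_d}).
Hypotheses (nu_dec : nonincr nu) (nu_n : (nu 0%N <= n.+1)%N).
Hypotheses (T_svt : svt d nu T).
Hypothesis T_neq0 : \prod_(t in T) wt t.2 t.1.1 t.1.2 != 0.

Let nu_le i : (nu i <= n.+1)%N.
Proof. exact: leq_trans (nonincr_leq nu_dec (leq0n i)) nu_n. Qed.
Let T1 i j r : has_entry T i j r -> (r < d)%N /\ (j < nu i)%N.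
Proof. by have /(svtP _ _ nu_le)[H _ _ _] := T_svt; exact: H. Qed.
Let T2 i j : (i < d)%N -> (j < nu i)%N -> exists r, has_entry T i j r.
Proof. by have /(svtP _ _ nu_le)[_ H _ _] := T_svt; exact: H. Qed.
Let T3 i j j' r r' : has_entry T i j r -> has_entry T i j' r' -> (j < j')%N -> (r <= r')%N.
Proof. by have /(svtP _ _ nu_le)[_ _ H _] := T_svt; exact: H. Qed.
Let T4 i i' j r r' : has_entry T i j r -> has_entry T i' j r' -> (i < i')%N -> (r < r')%N.
Proof. by have /(svtP _ _ nu_le)[_ _ _ H] := T_svt; exact: H. Qed.

Lemma entry_neq (i j r : nat) : has_entry T i j r -> (lam (d.-1 - r) + i)%N != j.
Proof.
move=> ijr; have ir := svt_row_le nu_dec nu_le T_svt ijr.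
have [id jn rd] := has_entry_lt ijr.
have tT : (Ordinal id, Ordinal jn, Ordinal rd) \in T by rewrite -has_entry_ord.
have /prodf_neq0/(_ _ tT) := T_neq0; rewrite /= entry_wt_spec //.
by apply: contraNneq => <-; rewrite natrD subrr mulr0 mul0r.
Qed.

(** Along row 0 the letters, hence the values [lam (d.-1 - r)], do not decrease, while [j] grows by
    1 at a time; by [entry_neq] it never hits the value, so it stays below. *)
Lemma top_row_lt (j r : nat) : has_entry T 0 j r -> (j < lam (d.-1 - r))%N.
Proof.
elim: j r => [|j IHj] r h; have := entry_neq h; rewrite addn0; first by lia.
have [d0 _ _] := has_entry_lt h; have [_ jnu] := T1 h.
have [r0 h0] := T2 d0 (ltnW jnu).
have := IHj _ h0; have r0r := T3 h0 h (ltnSn j).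
have := nonincr_leq lam_dec (leq_sub2l d.-1 r0r); lia.
Qed.

Lemma column_top (i j r : nat) :
  has_entry T i j r -> exists2 r0, has_entry T 0 j r0 & (r0 + i <= r)%N.
Proof.
elim: i r => [|i IHi] r h; first by exists r; rewrite ?addn0.
have [id _ _] := has_entry_lt h; have [_ jnu] := T1 h.
have [r' h'] := T2 (ltnW id) (leq_trans jnu (nu_dec i)).
have [r0 h0 le0] := IHi _ h'; exists r0 => //.
by have := T4 h' h (ltnSn i); lia.
Qed.

(** A column reaching row [i] starts with a letter [r0 <= d.-1 - i], so the bound from row 0 is a
    part of index at least [i]. *)
Lemma column_lt (i j r : nat) : has_entry T i j r -> (j < lam i)%N.
Proof.
move=> h; have [r0 h0 le0] := column_top h; have [_ _ rd] := has_entry_lt h.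
apply: leq_trans (top_row_lt h0) (nonincr_leq lam_dec _); lia.
Qed.

Lemma shape_le_lam (i : nat) : (i < d)%N -> (nu i <= lam i)%N.
Proof.
move=> id; rewrite leqNgt; apply/negP => lt_nu.
by have [r /column_lt] := T2 id lt_nu; rewrite ltnn.
Qed.

Lemma entry_ge (i j r : nat) : has_entry T i j r -> (d + i <= r + lam' j)%N.
Proof.
move=> h; have [r0 h0 le0] := column_top h; have [_ _ rd] := has_entry_lt h.
by have := top_row_lt h0; rewrite -lam'E; lia.
Qed.
End Nonvanishing.

Lemma svt_sum_eq0 (nu : nat -> nat) (i : nat) :
  nonincr nu -> (nu 0%N <= n.+1)%N -> (i < d)%N -> (lam i < nu i)%N -> S d nu = 0.
Proof.
move=> nu_dec nu_n id lt_nu; apply: big1 => T T_svt; apply/eqP.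
apply: contraTT lt_nu => T_neq0; rewrite -leqNgt.
exact: shape_le_lam T_svt T_neq0 _ id.
Qed.

(** Column [j] holds the largest [lam' j] letters, one in each cell. *)
Definition lam_tableau : {set 'I_d * 'I_n.+1 * 'I_d} :=
  entries d n.+1 (fun i j r => (j < lam i)%N && (r + lam' j == d + i)%N).

Let lam_le i : (lam i <= n.+1)%N.
Proof. exact: leqW (leq_trans (nonincr_leq lam_dec (leq0n i)) lam_n). Qed.

Lemma conj_le (j : nat) : (lam' j <= d)%N.
Proof. by rewrite leqNgt lam'E lam_d. Qed.

Lemma conj_dec (j j' : nat) : (j <= j')%N -> (lam' j' <= lam' j)%N.
Proof.
move=> jj'; case E: (lam' j') => [//|m].
have := ltnSn m; rewrite -[X in (m < X)%N -> _]E !lam'E; exact: leq_ltn_trans.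
Qed.

Lemma has_lam_tableau (i j r : nat) :
  has_entry lam_tableau i j r = (j < lam i)%N && (r + lam' j == d + i)%N.
Proof.
rewrite has_entries; apply/and4P/idP => [[] //|/andP[jl /eqP rE]].
have := conj_le j; have := lam_le i; have := lam'E i j; rewrite jl rE eqxx /= => h1 h2 h3.
by split=> //; lia.
Qed.

Lemma svt_lam_tableau : svt d lam lam_tableau.
Proof.
apply/(svtP _ _ lam_le); split.
- move=> i j r; rewrite has_lam_tableau => /andP[jl /eqP rE]; split=> //.
  by have := lam'E i j; rewrite jl; lia.
- move=> i j id jl; exists (d + i - lam' j)%N; rewrite has_lam_tableau jl /=.
  by have := conj_le j; lia.
- move=> i j j' r r'; rewrite !has_lam_tableau => /andP[_ /eqP rE] /andP[_ /eqP rE'] jj'.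
  by have := conj_dec (ltnW jj'); lia.
- by move=> i i' j r r'; rewrite !has_lam_tableau => /andP[_ /eqP rE] /andP[_ /eqP rE']; lia.
Qed.

(* Nonvanishing forces the entries of column [j] to be at least
   [d - lam'_j, ..., d - 1], hence equal to them. *)
Lemma lam_tableau_unique (T : {set 'I_d * 'I_n.+1 * 'I_d}) :
  svt d lam T -> \prod_(t in T) wt t.2 t.1.1 t.1.2 != 0 -> T = lam_tableau.
Proof.
move=> T_svt T_neq0; have /(svtP _ _ lam_le)[T1 T2 _ T4] := T_svt.
have entryE i j r : has_entry T i j r -> (r + lam' j)%N = (d + i)%N.
  move=> h; have := entry_ge lam_dec (lam_le 0%N) T_svt T_neq0 h.
  have [_ jl] := T1 _ _ _ h.
  suff : (r + (lam' j).-1 < d + i)%N by have := lam'E i j; rewrite jl; lia.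
  (* The upper bound on [r]: letters grow by at least 1 per row down to the bottom of the column,
     where they are still below [d]. *)
  have down m : (i <= m)%N -> (m < lam' j)%N -> exists2 r', has_entry T m j r' & (r + m <= r' + i)%N.
    elim: m => [|m IHm]; first by rewrite leqn0 => /eqP i0; subst i; exists r.
    rewrite leq_eqVlt => /predU1P[<-|im] ml; first by exists r.
    have [r' h' le'] := IHm im (ltnW ml).
    have m1l : (j < lam m.+1)%N by rewrite -lam'E.
    have [r'' h''] := T2 m.+1 j (leq_trans ml (conj_le j)) m1l.
    by exists r'' => //; have := T4 _ _ _ _ _ h' h'' (ltnSn m); lia.
  have il : (i < lam' j)%N by rewrite lam'E.
  have [||r' h' le'] := down (lam' j).-1; try lia.
  by have [_ _ rd] := has_entry_lt h'; lia.
apply: has_entry_inj => i j r; rewrite has_lam_tableau.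
apply/idP/andP => [h|[jl /eqP rE]].
  by have [_ ->] := T1 _ _ _ h; rewrite (entryE _ _ _ h).
have id : (i < d)%N by apply: leq_trans (conj_le j); rewrite lam'E.
have [r' h] := T2 i j id jl.
by have -> : r = r' by have := entryE _ _ _ h; lia.
Qed.

Lemma svt_sum_lam :
  S d lam = \prod_(p < d) \prod_(j < lam p)
     (- beta * (lam p - j + (lam' j - p.+1))%:R / (1 + beta * (lam p + (d - p))%:R)).
Proof.
rewrite /svt_sum (bigD1 _ svt_lam_tableau) /= [X in _ + X]big1 ?addr0; last first.
  move=> T /andP[T_svt]; apply: contraNeq => T_neq0.
  by apply/eqP; exact: lam_tableau_unique.
rewrite (prod_triples _ _ _ (fun i j r => wt r i j)).
pose G p j := - beta * (lam p - j + (lam' j - p.+1))%:R / (1 + beta * (lam p + (d - p))%:R).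
pose H i j := wt (d + i - lam' j) i j.
transitivity (\prod_(i < d) \prod_(j < n.+1) (if (j < lam i)%N then H i j else 1)).
  apply: eq_bigr => i _; apply: eq_bigr => j _.
  have := lam'E i j; case: ifPn => jl il; last by rewrite big_pred0.
  have rd : (d + i - lam' j < d)%N by have := ltn_ord i; lia.
  rewrite (big_pred1 (Ordinal rd)) // => r /=.
  by rewrite -val_eqE /=; have := conj_le j; lia.
transitivity (\prod_(i < d) \prod_(j < n.+1) (if (j < lam i)%N then G i j else 1)); last first.
  apply: eq_bigr => p _; rewrite (big_ord_widen n.+1 (G p) (lam_le p)) -big_mkcond /=.
  by apply: eq_bigl => j.
rewrite exchange_big [RHS]exchange_big /=; apply: eq_bigr => j _.
have restrict (F : nat -> nat -> R) :
  \prod_(i < d) (if (j < lam i)%N then F i j else 1) = \prod_(i < lam' j) F i j.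
  rewrite (big_ord_widen d (fun i => F i j) (conj_le j)) -big_mkcond /=.
  by apply: eq_bigl => i; rewrite lam'E.
(* The letter in row [i] of column [j] refers to row [p = lam' j - 1 - i] of [lam], so turning each
   column upside down makes [lam p + i - j] the hook length at [(p, j)]. *)
rewrite (restrict H) (restrict G) (reindex_inj rev_ord_inj) /=.
apply: eq_bigr => p _; have pl := ltn_ord p; have := lam'E p j; rewrite pl => jl.
have := conj_le j; move=> lamd.
rewrite /H /G entry_wt_spec; last by lia.
have -> : (d.-1 - (d + (lam' j - p.+1) - lam' j) = p)%N by lia.
have -> : (lam p + (d + (lam' j - p.+1) - lam' j).+1 = lam p + (d - p))%N by lia.
congr (_ * _ / _); rewrite natrD [(lam p - j)%:R]natrB; last by lia.
by rewrite addrAC.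
Qed.
End Specialization.

(** * Increasing tableaux *)

Lemma count_ltn_iota (m n : nat) :
  (m <= n)%N -> count (fun j => (j < m)%N) (iota 0 n) = m.
Proof.
move=> mn; rewrite -(subnKC mn) iotaD count_cat.
have /eqP -> : count (fun j => (j < m)%N) (iota 0 m) == m.
  rewrite -[eqbRHS](size_iota 0) -all_count; apply/allP => j.
  by rewrite mem_iota.
rewrite (eq_in_count (a2 := pred0)) ?count_pred0 ?addn0 // => j.
by rewrite mem_iota => /andP[mj _]; rewrite ltnNge mj.
Qed.

Section Increasing.
Variables (d n K : nat) (lam : nat -> nat).
Hypotheses (lam_dec : nonincr lam) (lam_d : lam d = 0%N) (lam_n : (lam 0%N <= n)%N).
Local Notation filling := {ffun 'I_d * 'I_n -> 'I_K.+1}.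

Definition at_cell (t : filling) (i j : nat) : nat :=
  if insub i is Some u then if insub j is Some v then t (u, v) else 0 else 0.

Definition fill (f : nat -> nat -> nat) : filling := [ffun p : 'I_d * 'I_n => inord (f p.1 p.2)].

Definition max_entry (t : filling) : nat := \max_p t p.

(* Cells outside of [lam/mu] hold 0, so that subtracting 1 everywhere turns a
   tableau of shape [lam/mu] into one of shape [lam/nu], where [nu] is [mu]
   together with the cells of entry 1. *)
Definition sit (mu : nat -> nat) (t : filling) : bool :=
  [&& [forall p : 'I_d * 'I_n, (0 < t p)%N == (mu p.1 <= p.2 < lam p.1)%N],
      [forall p : 'I_d * 'I_n, forall q : 'I_d * 'I_n,
         [&& p.1 == q.1, p.2 < q.2, 0 < t p & 0 < t q]%N ==> (t p < t q)%N],
      [forall p : 'I_d * 'I_n, forall q : 'I_d * 'I_n,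
         [&& p.2 == q.2, p.1 < q.1, 0 < t p & 0 < t q]%N ==> (t p < t q)%N]
    & [forall k : 'I_K.+1, (0 < k <= max_entry t)%N ==> [exists p, t p == k]]].

Lemma at_cell_ord (t : filling) (i : 'I_d) (j : 'I_n) : at_cell t i j = t (i, j).
Proof. by rewrite /at_cell !valK. Qed.

Lemma at_cell_gt0 (t : filling) (i j : nat) : (0 < at_cell t i j)%N -> (i < d)%N /\ (j < n)%N.
Proof. by rewrite /at_cell; do 2 case: insubP => //. Qed.

Lemma at_cell_inj (t u : filling) :
  (forall i j, (i < d)%N -> (j < n)%N -> at_cell t i j = at_cell u i j) -> t = u.
Proof.
move=> tu; apply/ffunP => -[i j]; apply: val_inj.
by rewrite /= -!at_cell_ord tu.
Qed.

Lemma at_cell_fill (f : nat -> nat -> nat) (i j : nat) :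
  (i < d)%N -> (j < n)%N -> (f i j <= K)%N -> at_cell (fill f) i j = f i j.
Proof.
move=> id jn fK; rewrite (at_cell_ord _ (Ordinal id) (Ordinal jn)) ffunE inordK //.
Qed.

Lemma at_cell_le (t : filling) (i j : nat) : (at_cell t i j <= K)%N.
Proof. by rewrite /at_cell; do 2 case: insubP => // *; rewrite -ltnS. Qed.

Lemma at_cell_max (t : filling) (i j : nat) : (at_cell t i j <= max_entry t)%N.
Proof.
rewrite /at_cell; case: insubP => // u _ _; case: insubP => // v _ _.
exact: (@leq_bigmax _ (fun p => nat_of_ord (t p))).
Qed.

Lemma max_entryP (t : filling) :
  max_entry t = 0%N \/ exists i j, at_cell t i j = max_entry t.
Proof.
case: (posnP (max_entry t)) => [|gt0]; [by left | right].
have [] := @eq_bigmax_cond _ predT (fun p => nat_of_ord (t p)).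
  rewrite lt0n; apply/eqP => c0; move: gt0; rewrite /max_entry big_pred0 // => p.
  exact: (card0_eq c0 p).
by move=> [i j] _ E; exists i, j; rewrite at_cell_ord /max_entry E.
Qed.

Lemma max_entry_eq (t : filling) (m : nat) : (forall i j, (at_cell t i j <= m)%N) ->
  (0 < m -> exists i j, at_cell t i j = m)%N -> max_entry t = m.
Proof.
move=> le_m m_at; apply/eqP; rewrite eqn_leq; apply/andP; split.
  by case: (max_entryP t) => [->|[i [j <-]]].
by case: m m_at {le_m} => // m [//|i [j <-]]; exact: at_cell_max.
Qed.

Lemma sitP (mu : nat -> nat) (t : filling) :
  reflect [/\ forall i j, (0 < at_cell t i j)%N = (mu i <= j < lam i)%N,
    forall i j j', (j < j')%N -> (0 < at_cell t i j)%N -> (0 < at_cell t i j')%N ->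
      (at_cell t i j < at_cell t i j')%N,
    forall i i' j, (i < i')%N -> (0 < at_cell t i j)%N -> (0 < at_cell t i' j)%N ->
      (at_cell t i j < at_cell t i' j)%N
  & forall k, (0 < k <= max_entry t)%N -> exists i j, at_cell t i j = k]
  (sit mu t).
Proof.
apply: (iffP and4P) => -[].
  move=> /forallP T1 /forallP T2 /forallP T3 /forallP T4; split.
  - move=> i j; apply/idP/idP => [h|/andP[h1 h2]].
      have [id jn] := at_cell_gt0 h.
      have /eqP <- := T1 (Ordinal id, Ordinal jn).
      by move: h; rewrite (at_cell_ord _ (Ordinal id) (Ordinal jn)).
    have id : (i < d)%N.
      by rewrite ltnNge; apply/negP => /(nonincr_leq lam_dec); lia.
    have jn : (j < n)%N by have := nonincr_leq lam_dec (leq0n i); lia.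
    rewrite (at_cell_ord _ (Ordinal id) (Ordinal jn)).
    by have /eqP -> := T1 (Ordinal id, Ordinal jn); rewrite /= h1.
  - move=> i j j' jj' h h'; have [id jn] := at_cell_gt0 h; have [_ jn'] := at_cell_gt0 h'.
    move: h h'; rewrite !(at_cell_ord _ (Ordinal id) (Ordinal _)) => h h'.
    have /forallP/(_ (Ordinal id, Ordinal jn'))/implyP := T2 (Ordinal id, Ordinal jn).
    by rewrite /= eqxx jj' h h' => ->.
  - move=> i i' j ii' h h'; have [id jn] := at_cell_gt0 h; have [id' _] := at_cell_gt0 h'.
    move: h h'; rewrite !(at_cell_ord _ (Ordinal _) (Ordinal jn)) => h h'.
    have /forallP/(_ (Ordinal id', Ordinal jn))/implyP := T3 (Ordinal id, Ordinal jn).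
    by rewrite /= eqxx ii' h h' => ->.
  - move=> k kP; have kK : (k < K.+1)%N.
      rewrite ltnS; case/andP: kP => _ /leq_trans; apply.
      by case: (max_entryP t) => [->|[i [j <-]]] //; exact: at_cell_le.
    have /implyP/(_ kP)/existsP[[i j] /eqP E] := T4 (Ordinal kK).
    by exists i, j; rewrite at_cell_ord E.
move=> T1 T2 T3 T4; split.
- by apply/forallP => -[i j]; rewrite -T1 at_cell_ord eqxx.
- apply/forallP => -[i j]; apply/forallP => -[i' j']; apply/implyP => /=.
  move=> /and4P[/eqP ii' jj' h h']; subst i'; have := T2 i j j' jj'.
  by rewrite !at_cell_ord; apply.
- apply/forallP => -[i j]; apply/forallP => -[i' j']; apply/implyP => /=.
  move=> /and4P[/eqP jj' ii' h h']; subst j'; have := T3 i i' j ii'.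
  by rewrite !at_cell_ord; apply.
- apply/forallP => k; apply/implyP => kP; apply/existsP.
  have [i [j E]] := T4 _ kP; have [id jn] : (i < d)%N /\ (j < n)%N.
    by apply: (@at_cell_gt0 t); rewrite E; case/andP: kP.
  exists (Ordinal id, Ordinal jn); rewrite -val_eqE /= -E.
  by rewrite (at_cell_ord _ (Ordinal id) (Ordinal jn)).
Qed.

(** An entry 1 can only occupy the first cell of its row outside [mu], so rows suffice to record the
    entries 1. *)
Definition first_rows (mu : nat -> nat) (t : filling) : {set 'I_d} :=
  [set i : 'I_d | at_cell t i (mu i) == 1%N].
Definition decrement (t : filling) : filling := fill (fun i j => (at_cell t i j).-1).
Definition increment (mu : nat -> nat) (t : filling) : filling :=
  fill (fun i j => if (mu i <= j < lam i)%N then (at_cell t i j).+1 else 0%N).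

Definition skew_size (mu : nat -> nat) : nat := \sum_(i < d) (lam i - mu i).

Definition step (mu : nat -> nat) (e : {set 'I_d}) : bool :=
  [&& e != set0, addable mu e & [forall i in e, (mu i < lam i)%N]].

Lemma at_decrement (t : filling) (i j : nat) : at_cell (decrement t) i j = (at_cell t i j).-1.
Proof.
case: (ltnP i d) => [id|di]; last by rewrite /at_cell insubN // -leqNgt.
case: (ltnP j n) => [jn|nj]; last by rewrite /at_cell insubT /= insubN // -leqNgt.
by rewrite at_cell_fill // (leq_trans (leq_pred _)) // at_cell_le.
Qed.

Lemma max_decrement (t : filling) : max_entry (decrement t) = (max_entry t).-1.
Proof.
apply: max_entry_eq => [i j|gt0].
  by rewrite at_decrement; have := at_cell_max t i j; lia.
case: (max_entryP t) => [E|[i [j E]]]; first by rewrite E in gt0.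
by exists i, j; rewrite at_decrement E.
Qed.

Lemma skew_size_raise (mu : nat -> nat) (e : {set 'I_d}) :
  step mu e -> (skew_size (raise mu e) < skew_size mu)%N.
Proof.
(* [lia] would make the lemma depend on these. *)
clear lam_dec lam_d lam_n.
case/and3P => /set0Pn[i0 ie] _ /forall_inP lt_lam.
rewrite /skew_size (bigD1 i0) //= [ltnRHS](bigD1 i0) //= -addSn leq_add //.
  by have := lt_lam _ ie; rewrite /raise at_row_ord ie; lia.
by apply: leq_sum => i _; rewrite /raise; lia.
Qed.

Section FirstStep.
Variables (mu : nat -> nat) (t : filling).
Hypothesis t_sit : sit mu t.
Local Notation e := (first_rows mu t).

Let T1 i j : (0 < at_cell t i j)%N = (mu i <= j < lam i)%N.
Proof. by have /sitP[H _ _ _] := t_sit; exact: H. Qed.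
Let T2 i j j' : (j < j')%N -> (0 < at_cell t i j)%N -> (0 < at_cell t i j')%N ->
  (at_cell t i j < at_cell t i j')%N.
Proof. by have /sitP[_ H _ _] := t_sit; exact: H. Qed.
Let T3 i i' j : (i < i')%N -> (0 < at_cell t i j)%N -> (0 < at_cell t i' j)%N ->
  (at_cell t i j < at_cell t i' j)%N.
Proof. by have /sitP[_ _ H _] := t_sit; exact: H. Qed.
Let T4 k : (0 < k <= max_entry t)%N -> exists i j, at_cell t i j = k.
Proof. by have /sitP[_ _ _ H] := t_sit; exact: H. Qed.

Lemma at_cell_eq1 (i j : nat) :
  at_cell t i j = 1%N -> j = mu i /\ at_row e i.
Proof.
move=> tij; have jP : (mu i <= j < lam i)%N by rewrite -T1 tij.
have jE : j = mu i.
  apply/eqP; rewrite eqn_leq; case/andP: (jP) => -> jl; rewrite andbT leqNgt.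
  apply/negP => mu_j; have mu_gt0 : (0 < at_cell t i (mu i))%N by rewrite T1; lia.
  by have := T2 mu_j mu_gt0; rewrite tij; lia.
split=> //; have [id _] : (i < d)%N /\ (j < n)%N by apply: (@at_cell_gt0 t); rewrite tij.
by rewrite (at_row_ord _ (Ordinal id)) inE /= -jE tij.
Qed.

Lemma first_rows_at (i : nat) : at_row e i -> at_cell t i (mu i) = 1%N.
Proof.
move=> ei; have id := at_row_lt ei; move: ei.
by rewrite (at_row_ord _ (Ordinal id)) inE => /eqP.
Qed.

(** No cell of [lam/mu] can lie above an entry 1, which makes its cell addable to [mu]. *)
Lemma first_rows_step : (0 < max_entry t)%N -> step mu e.
Proof.
move=> gt0; apply/and3P; split.
- have [i [j /at_cell_eq1[_ ei]]] := T4 (k := 1%N) gt0.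
  apply/set0Pn; exists (Ordinal (at_row_lt ei)).
  by rewrite -at_row_ord.
- apply/(at_rowP _ (fun i => (i == 0%N) || (mu i < mu i.-1)%N)) => -[//|i] ei /=.
  have tE := first_rows_at ei; have := T1 i.+1 (mu i.+1); rewrite tE => /esym/andP[_ lt_lam].
  rewrite ltnNge; apply/negP => le_mu.
  have t_gt0 : (0 < at_cell t i (mu i.+1))%N.
    by rewrite T1 le_mu (leq_trans lt_lam (lam_dec i)).
  by have := T3 (ltnSn i) t_gt0; rewrite tE; lia.
- apply/(at_rowP _ (fun i => (mu i < lam i)%N)) => i /first_rows_at tE.
  by have := T1 i (mu i); rewrite tE => /esym/andP[].
Qed.

Lemma sit_decrement : sit (raise mu e) (decrement t).
Proof.
apply/sitP; split.
- move=> i j; rewrite at_decrement -subn1 subn_gt0.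
  apply/idP/idP => [gt1|/andP[le_j jl]].
    have := T1 i j; rewrite (ltnW gt1) => /esym/andP[le_j ->]; rewrite andbT /raise.
    case: (boolP (at_row e i)) => [/first_rows_at tE|_]; last by rewrite addn0.
    rewrite addn1 ltn_neqAle le_j andbT; apply: contraTneq gt1 => jE.
    by rewrite -jE tE.
  have gt0 : (0 < at_cell t i j)%N by rewrite T1 jl andbT; rewrite /raise in le_j; lia.
  rewrite ltn_neqAle gt0 andbT eq_sym; apply/negP => /eqP/at_cell_eq1[jE ei].
  by move: le_j; rewrite /raise ei jE; lia.
- by move=> i j j' jj'; rewrite !at_decrement => h h'; have := T2 jj' (i := i); lia.
- by move=> i i' j ii'; rewrite !at_decrement => h h'; have := T3 ii' (j := j); lia.
- move=> k; rewrite max_decrement => kP.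
  have [|i [j E]] := T4 (k := k.+1); first by lia.
  by exists i, j; rewrite at_decrement E.
Qed.

Lemma increment_decrement : increment mu (decrement t) = t.
Proof.
apply: at_cell_inj => i j id jn; rewrite at_cell_fill // at_decrement -T1.
  by case: ltnP => h; lia.
by have := at_cell_le t i j; case: ifP; lia.
Qed.
End FirstStep.

(** Each value occupies at least one cell. The bound guarantees that [increment] does not leave
    ['I_K.+1]. *)
Lemma max_entry_le (mu : nat -> nat) (t : filling) :
  nonincr mu -> sit mu t -> (max_entry t <= skew_size mu)%N.
Proof.
have [N] := ubnP (skew_size mu); elim: N mu t => // N IHN mu t lt_N mu_dec t_sit.
case: (posnP (max_entry t)) => [->//|gt0].
have st := first_rows_step t_sit gt0.
have lt_size := skew_size_raise st.
case/and3P: st => _ add _; have := IHN _ _ _ (addable_raise mu_dec add) (sit_decrement t_sit).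
by rewrite max_decrement; lia.
Qed.

Section Increment.
Variables (mu : nat -> nat) (e : {set 'I_d}) (t : filling).
Hypotheses (mu_dec : nonincr mu) (mu_K : (skew_size mu <= K)%N).
Hypotheses (e_step : step mu e) (t_sit : sit (raise mu e) t).

Let T1 i j : (0 < at_cell t i j)%N = (raise mu e i <= j < lam i)%N.
Proof. by have /sitP[H _ _ _] := t_sit; exact: H. Qed.
Let T2 i j j' : (j < j')%N -> (0 < at_cell t i j)%N -> (0 < at_cell t i j')%N ->
  (at_cell t i j < at_cell t i j')%N.
Proof. by have /sitP[_ H _ _] := t_sit; exact: H. Qed.
Let T3 i i' j : (i < i')%N -> (0 < at_cell t i j)%N -> (0 < at_cell t i' j)%N ->
  (at_cell t i j < at_cell t i' j)%N.
Proof. by have /sitP[_ _ H _] := t_sit; exact: H. Qed.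
Let T4 k : (0 < k <= max_entry t)%N -> exists i j, at_cell t i j = k.
Proof. by have /sitP[_ _ _ H] := t_sit; exact: H. Qed.
Let e_add i : at_row e i -> (i == 0%N) || (mu i < mu i.-1)%N.
Proof.
case/and3P: e_step => _ add _.
exact: (at_rowP e (fun i => (i == 0%N) || (mu i < mu i.-1)%N) add).
Qed.
Let e_lam i : at_row e i -> (mu i < lam i)%N.
Proof.
case/and3P: e_step => _ _ H.
exact: (at_rowP e (fun i => (mu i < lam i)%N) H).
Qed.

Let max_lt : (max_entry t < K)%N.
Proof.
case/and3P: (e_step) => _ add _.
have := max_entry_le (addable_raise mu_dec add) t_sit.
by have := skew_size_raise e_step; lia.
Qed.

Lemma at_increment (i j : nat) : at_cell (increment mu t) i j
  = if (mu i <= j < lam i)%N then (at_cell t i j).+1 else 0%N.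
Proof.
case: (ltnP i d) => [id|di]; last first.
  have lam0 := nonincr_leq lam_dec di; rewrite lam_d in lam0.
  by rewrite ifF; [rewrite /at_cell insubN // -leqNgt | lia].
case: (ltnP j n) => [jn|nj]; last first.
  have lam_i := nonincr_leq lam_dec (leq0n i).
  by rewrite ifF; [rewrite /at_cell insubT /= insubN // -leqNgt | lia].
rewrite at_cell_fill //; case: ifP => // _.
exact: leq_ltn_trans (at_cell_max _ _ _) max_lt.
Qed.

Lemma max_increment : max_entry (increment mu t) = (max_entry t).+1.
Proof.
apply: max_entry_eq => [i j|_].
  by rewrite at_increment; case: ifP => // _; rewrite ltnS at_cell_max.
case: (posnP (max_entry t)) => [E|gt0]; last first.
  have [|i [j E]] := T4 (k := max_entry t); first by rewrite gt0 leqnn.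
  exists i, j; rewrite at_increment E ifT //.
  by have := T1 i j; rewrite E gt0 /raise; lia.
case/and3P: e_step => /set0Pn[i ie] _ _.
have ei : at_row e i by rewrite at_row_ord.
exists i, (mu i); rewrite at_increment leqnn e_lam //=.
by have := at_cell_max t i (mu i); lia.
Qed.

Lemma sit_increment : sit mu (increment mu t).
Proof.
have inside i j : (0 < at_cell (increment mu t) i j)%N = (mu i <= j < lam i)%N.
  by rewrite at_increment; case: ifP.
apply/sitP; split=> //.
- move=> i j j' jj'; rewrite !inside !at_increment => h h'; rewrite h h' ltnS.
  have gt0 : (0 < at_cell t i j')%N by rewrite T1 /raise; lia.
  by case: (posnP (at_cell t i j)) => [->//|gt0']; exact: T2.
- move=> i i' j ii'; rewrite !inside !at_increment => h h'; rewrite h h' ltnS.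
  have gt0 : (0 < at_cell t i' j)%N.
    (* If row [i'] gains a cell, its column is [mu i' < mu i'.-1 <= mu i <= j], so that cell is not
       [(i', j)]. *)
    rewrite T1 /raise; case: (boolP (at_row e i')) => [ei|_]; last by rewrite addn0.
    have := e_add ei; have : (mu i'.-1 <= mu i)%N by apply: (nonincr_leq mu_dec); lia.
    by lia.
  by case: (posnP (at_cell t i j)) => [->//|gt0']; exact: T3.
- move=> k; rewrite max_increment => /andP[k0 kmax].
  case: (eqVneq k 1%N) => [->|k1].
    case/and3P: e_step => /set0Pn[i ie] _ _.
    have ei : at_row e i by rewrite at_row_ord.
    exists i, (mu i); rewrite at_increment leqnn e_lam //=.
    by have := T1 i (mu i); rewrite /raise ei; lia.
  have [|i [j E]] := T4 (k := k.-1); first by lia.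
  exists i, j; rewrite at_increment E ifT; first by lia.
  by have := T1 i j; rewrite E /raise; lia.
Qed.

Lemma first_rows_increment : first_rows mu (increment mu t) = e.
Proof.
apply/setP => i; rewrite inE at_increment leqnn /= -at_row_ord.
have := T1 i (mu i); have := @e_lam i; rewrite /raise.
by case: (at_row e i) => [/(_ isT)|_]; case: ifP => //; lia.
Qed.

Lemma decrement_increment : decrement (increment mu t) = t.
Proof.
apply: at_cell_inj => i j id jn; rewrite at_decrement at_increment.
case: ifP => //= h; apply/esym/eqP; rewrite -leqn0 leqNgt T1.
by move/negbT: h; apply: contra; rewrite /raise; lia.
Qed.
End Increment.

Section Weight.
Variables (R : fieldType) (c : (nat -> nat) -> R).
Hypothesis c_ext : forall f g, (forall i, (i < d)%N -> f i = g i) -> c f = c g.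

(** For [k >= 1] the cells of [mu] are counted too, since they hold 0. *)
Definition shape_below (t : filling) (k i : nat) : nat :=
  count (fun j => (at_cell t i j < k)%N) (iota 0 (lam i)).

Definition sit_wt (t : filling) : R :=
  \prod_(1 <= k < (max_entry t).+1) (c (shape_below t k))^-1.

Definition sit_sum (mu : nat -> nat) : R := \sum_(t | sit mu t) sit_wt t.

(** The factor [k = 1] sees only the shape [mu]; in the others, decrementing shifts [k] by one. *)
Lemma sit_wt_decrement (mu : nat -> nat) (t : filling) :
  nonincr mu -> (forall i, mu i <= lam i)%N -> sit mu t -> (0 < max_entry t)%N ->
  sit_wt t = (c mu)^-1 * sit_wt (decrement t).
Proof.
move=> mu_dec mu_lam t_sit gt0; have /sitP[T1 _ _ _] := t_sit.
rewrite /sit_wt max_decrement prednK // big_ltn //; congr (_^-1 * _).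
  apply: c_ext => i id; rewrite /shape_below.
  rewrite (eq_in_count (a2 := fun j => (j < mu i)%N)) => [|j].
    exact: count_ltn_iota.
  by rewrite mem_iota /= => jl; have := T1 i j; lia.
rewrite big_add1 /=; apply: eq_big_nat => k /andP[k0 _].
congr _^-1; apply: c_ext => i _.
by apply: eq_count => j; rewrite at_decrement; lia.
Qed.

Lemma sit_sum_rec (mu : nat -> nat) :
  nonincr mu -> (forall i, mu i <= lam i)%N -> (skew_size mu <= K)%N ->
  (0 < skew_size mu)%N ->
  sit_sum mu = (c mu)^-1 * \sum_(e : {set 'I_d} | step mu e) sit_sum (raise mu e).
Proof.
move=> mu_dec mu_lam mu_K size_gt0.
have max_gt0 t : sit mu t -> (0 < max_entry t)%N.
  move=> /sitP[T1 _ _ _]; rewrite lt0n; apply: contraTneq size_gt0 => max0.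
  rewrite -leqNgt leqn0 sum_nat_eq0; apply/forallP => i /=.
  rewrite subn_eq0 leqNgt; apply/negP => lt_mu.
  have := at_cell_max t i (mu i); have := T1 i (mu i); lia.
rewrite /sit_sum (partition_big (first_rows mu) (step mu)) => [|t t_sit]; last first.
  exact: first_rows_step (max_gt0 _ t_sit).
rewrite mulr_sumr; apply: eq_bigr => e e_step.
rewrite (reindex_onto (increment mu) decrement) => [|t /andP[t_sit _]]; last first.
  exact: increment_decrement.
rewrite mulr_sumr; apply: eq_big => [t|t /andP[/andP[t_sit _] /eqP E]]; last first.
  by rewrite (sit_wt_decrement mu_dec mu_lam t_sit) ?E // max_gt0.
apply/andP/idP => [[/andP[t_sit /eqP eE] /eqP tE]|t_sit].
  by have := sit_decrement t_sit; rewrite eE tE.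
rewrite (sit_increment mu_dec mu_K e_step t_sit).
rewrite (first_rows_increment mu_dec mu_K e_step t_sit).
by rewrite (decrement_increment mu_dec mu_K e_step t_sit) !eqxx.
Qed.

Lemma sit_sum_lam (mu : nat -> nat) : (forall i, mu i = lam i) -> sit_sum mu = 1.
Proof.
move=> mu_lam; have at0 t : sit mu t -> max_entry t = 0%N.
  move=> /sitP[T1 _ _ _]; case: (max_entryP t) => // -[i [j E]].
  by have := T1 i j; rewrite mu_lam E; lia.
have z i j : at_cell (fill (fun _ _ => 0%N)) i j = 0%N.
  case: (ltnP i d) => [id|di]; last by rewrite /at_cell insubN // -leqNgt.
  case: (ltnP j n) => [jn|nj]; last by rewrite /at_cell insubT /= insubN // -leqNgt.
  by rewrite at_cell_fill.
rewrite /sit_sum (big_pred1 (fill (fun _ _ => 0%N))) => [|t].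
  rewrite /sit_wt (_ : max_entry _ = 0%N) ?big_geq //.
  by apply: max_entry_eq => // i j; rewrite z.
apply/idP/eqP => [t_sit|->].
  apply: at_cell_inj => i j _ _; rewrite z.
  by have := at_cell_max t i j; rewrite at0 //; lia.
apply/sitP; split=> [i j|i j j'|i i' j|k]; rewrite ?z ?mu_lam //; first by lia.
rewrite (@max_entry_eq _ 0%N) //; first by lia.
by move=> i j; rewrite z.
Qed.
End Weight.
End Increasing.

(** * Matching the recursion for increasing tableaux with the Pieri rule *)

Section SkewIdentity.
Variables (R : fieldType) (beta : R) (d K : nat) (lam : nat -> nat).
Hypothesis beta_unit : forall m : nat, 1 + beta * m%:R != 0.
Hypothesis beta_generic : forall f g : nat -> nat,
  \prod_(i < d) (1 + beta * (f i)%:R) = \prod_(i < d) (1 + beta * (g i)%:R) ->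
  (\prod_(i < d) (f i).+1 = \prod_(i < d) (g i).+1)%N.
Hypotheses (lam_dec : nonincr lam) (lam_d : lam d = 0%N).

Local Notation n := (lam 0%N).+1.
Local Notation S := (svt_sum (specX beta d lam) (specA beta) d n.+1 d).

Definition step_wt (nu : nat -> nat) : R :=
  \prod_(i < d) ((1 + beta * (nu i + (d - i))%:R) / (1 + beta * (lam i + (d - i))%:R)) - 1.

Lemma step_wt_ext (f g : nat -> nat) :
  (forall i, (i < d)%N -> f i = g i) -> step_wt f = step_wt g.
Proof. by move=> fg; congr (_ - 1); apply: eq_bigr => i _; rewrite fg. Qed.

(** [beta_generic] allows the comparison to be made at beta = 1, where the product for [nu] is
    strictly smaller than the one for [lam]. *)
Lemma step_wt_neq0 (nu : nat -> nat) :
  (forall i, nu i <= lam i)%N -> (0 < skew_size d lam nu)%N -> step_wt nu != 0.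
Proof.
move=> nu_lam; apply: contraTneq => /eqP.
rewrite /step_wt big_split /= prodfV subr_eq0 => /eqP E.
have {}E : \prod_(i < d) (1 + beta * (nu i + (d - i))%:R)
         = \prod_(i < d) (1 + beta * (lam i + (d - i))%:R).
  by apply: divr1_eq.
have {}E := @beta_generic (fun i => nu i + (d - i))%N (fun i => lam i + (d - i))%N E.
rewrite -leqNgt leqn0 sum_nat_eq0; apply/forallP => i /=.
rewrite subn_eq0 leqNgt; apply/negP => lt_lam.
have : (\prod_(i < d) (nu i + (d - i)).+1 < \prod_(i < d) (lam i + (d - i)).+1)%N.
  rewrite (bigD1 i) //= [ltnRHS](bigD1 i) //=.
  apply: (@leq_trans ((lam i + (d - i)).+1 * \prod_(j < d | j != i) (nu j + (d - j)).+1)).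
    by rewrite ltn_pmul2r ?ltnS ?ltn_add2r // prodn_gt0.
  by rewrite leq_pmul2l // leq_prod // => j _; rewrite ltnS leq_add2r.
by rewrite E ltnn.
Qed.

(** Identifies the Pieri factor with the product in the bracket, the letter [r] being matched with
    row [d.-1 - r]. *)
Lemma prod_spec (nu : nat -> nat) :
  \prod_(r < d) specX beta d lam r * \prod_(i < d) specA beta (beta_set d nu i)
  = step_wt nu + 1.
Proof.
rewrite /step_wt subrK (reindex_inj rev_ord_inj) -big_split /=.
apply: eq_bigr => i _; have id := ltn_ord i; rewrite /specX /specA mulrC /beta_set.
have -> : (d.-1 - (d - i.+1) = i)%N by lia.
have -> : (lam i + (d - i.+1).+1 = lam i + (d - i))%N by lia.
by have -> : (nu i + d - i = nu i + (d - i))%N by lia.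
Qed.

Lemma skew_identity (nu : nat -> nat) :
  nonincr nu -> (forall i, nu i <= lam i)%N -> (skew_size d lam nu <= K)%N ->
  sit_sum d n K lam step_wt nu * S lam = S nu.
Proof.
have [N] := ubnP (skew_size d lam nu); elim: N nu => // N IHN nu lt_N nu_dec nu_lam nu_K.
have nu_d : nu d = 0%N by apply/eqP; rewrite -leqn0 -lam_d.
have lam_n : (lam 0%N <= n)%N by [].
case: (posnP (skew_size d lam nu)) => [size0|size_gt0].
  have nuE i : nu i = lam i.
    case: (ltnP i d) => id; last first.
      have := nonincr_leq lam_dec id; rewrite lam_d.
      by have := nu_lam i; lia.
    apply/eqP; rewrite eqn_leq nu_lam /= -subn_eq0.
    by have /eqP := size0; rewrite sum_nat_eq0 => /forallP/(_ (Ordinal id)).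
  by rewrite sit_sum_lam // mul1r; apply: eq_svt_sum.
have c_neq0 := step_wt_neq0 nu_lam size_gt0.
rewrite (sit_sum_rec lam_dec lam_d lam_n step_wt_ext) // -mulrA mulr_suml.
have stepE (e : {set 'I_d}) : step lam nu e ->
    sit_sum d n K lam step_wt (raise nu e) * S lam = S (raise nu e).
  move=> e_step; have lt_size := skew_size_raise e_step.
  case/and3P: (e_step) => _ add /(at_rowP e (fun i => (nu i < lam i)%N)) lt_lam.
  apply: IHN; [lia | exact: addable_raise | | lia].
  move=> i; rewrite /raise; have := nu_lam i; have := lt_lam i.
  by case: (at_row e i) => [/(_ isT)|_]; lia.
rewrite (eq_bigr _ stepE); apply: (mulfI c_neq0); rewrite mulVKf //.
have pieri := svt_sum_pieri (fun r => invr_neq0 (beta_unit _)) beta_unit (leqnn d) nu_dec nu_d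
  (n := n) (X := specX beta d lam) (A := specA beta).
rewrite prod_spec in pieri.
have add0 : addable nu (set0 : {set 'I_d}) by apply/forall_inP => i; rewrite inE.
have nu_n : (nu 0 < n)%N by rewrite ltnS.
have := pieri nu_n; rewrite (bigD1 set0) //=.
have -> : S (raise nu (set0 : {set 'I_d})) = S nu.
  apply: eq_svt_sum => i; rewrite /raise (_ : at_row _ _ = false) ?addn0 //.
  by apply/existsP => -[u]; rewrite inE.
(* The term [e = set0] cancels the 1 in [step_wt nu + 1]. *)
rewrite mulrDl mul1r addrC => /addIr <-.
(* Sets of corners leaving [lam] occur in the Pieri rule but not in the tableau recursion; their
   sums vanish. *)
rewrite [RHS](bigID (fun e : {set 'I_d} => [forall i in e, (nu i < lam i)%N])) /=.
rewrite [X in _ = _ + X]big1 ?addr0.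
  by apply: eq_bigl => e; rewrite /step; case: (e != set0); rewrite /= ?andbT ?andbF.
move=> e /andP[/andP[add _]] /forall_inPn[i ie]; rewrite -leqNgt => le_nu.
have raise_dec := addable_raise nu_dec add.
apply: (svt_sum_eq0 beta_unit lam_dec lam_d lam_n (i := i)) => //.
  by rewrite /raise; have := nu_lam 0%N; lia.
by rewrite /raise at_row_ord ie addn1 ltnS.
Qed.
End SkewIdentity.

(** * Comparison with the lists of cells *)

Local Notation row s := (nth 0%N s).

Lemma mem_cells (s : seq nat) (i j : nat) : ((i.+1, j.+1) \in cells s) = (j < row s i)%N.
Proof.
apply/allpairsPdep/idP => [[i' [j' [_ + [-> ->]]]]|jr]; first by rewrite mem_iota.
exists i, j; rewrite !mem_iota; split=> //=.
by rewrite add0n ltnNge; apply: contraL jr => /(nth_default 0%N) ->.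
Qed.

Lemma cellsP (s : seq nat) (c : nat * nat) :
  c \in cells s -> exists i j, c = (i.+1, j.+1) /\ (j < row s i)%N.
Proof.
move=> cs; have /allpairsPdep[i [j [_ _ cE]]] := cs.
by exists i, j; split; rewrite // -mem_cells -cE.
Qed.

Lemma cells_uniq (s : seq nat) : uniq (cells s).
Proof.
apply: allpairs_uniq_dep => [|i _|]; [exact: iota_uniq | exact: iota_uniq |].
by move=> [i j] [i' j'] _ _ /= [-> ->].
Qed.

Lemma big_cells (R : Type) (idx : R) (op : Monoid.law idx) (s : seq nat) (F : nat * nat -> R) :
  \big[op/idx]_(c <- cells s) F c
  = \big[op/idx]_(0 <= i < size s) \big[op/idx]_(0 <= j < row s i) F (i.+1, j.+1).
Proof.
rewrite /cells big_allpairs_dep /index_iota subn0.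
by apply: eq_bigr => i _; rewrite subn0.
Qed.

Lemma big_rows (R : Type) (idx : R) (op : Monoid.law idx) (d : nat) (s : seq nat)
    (F : nat -> nat -> R) : (size s <= d)%N ->
  \big[op/idx]_(0 <= i < size s) \big[op/idx]_(0 <= j < row s i) F i j
  = \big[op/idx]_(i < d) \big[op/idx]_(j < row s i) F i j.
Proof.
move=> sd; rewrite -(big_mkord xpredT (fun i => \big[op/idx]_(j < row s i) F i j)).
rewrite [RHS](big_cat_nat (n := size s)) //= [X in op _ X]big_nat [X in op _ X]big1.
  by rewrite Monoid.mulm1; apply: eq_bigr => i _; rewrite big_mkord.
by move=> i /andP[si _]; rewrite nth_default // big_ord0.
Qed.

Lemma skew_uniq (lam mu : seq nat) : uniq (Defs.skew lam mu).
Proof. exact: filter_uniq (cells_uniq lam). Qed.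

Lemma mem_skew (lam mu : seq nat) (i j : nat) :
  ((i.+1, j.+1) \in Defs.skew lam mu) = (row mu i <= j < row lam i)%N.
Proof. by rewrite mem_filter !mem_cells -leqNgt. Qed.

Lemma skewP (lam mu : seq nat) (c : nat * nat) :
  c \in Defs.skew lam mu -> exists i j, c = (i.+1, j.+1) /\ (row mu i <= j < row lam i)%N.
Proof.
move=> cs; have : c \in cells lam by move: cs; rewrite mem_filter => /andP[].
by move=> /cellsP[i [j [cE _]]]; exists i, j; rewrite cE -mem_skew -cE.
Qed.

Lemma partition_nonincr (s : seq nat) : is_partition s -> nonincr (nth 0%N s).
Proof.
case/andP => s_sorted _ i; case: (ltnP i.+1 (size s)) => si; last by rewrite nth_default.
by move: s_sorted => /(sortedP 0%N)/(_ i si).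
Qed.

Lemma partition_size (s : seq nat) (d : nat) :
  is_partition s -> row s d = 0%N -> (size s <= d)%N.
Proof.
case/andP => _ /allP pos sd; rewrite leqNgt; apply/negP => /(mem_nth 0%N)/pos.
by rewrite sd.
Qed.

Section SIT.
Variables (d n : nat) (lam mu : seq nat).
Hypotheses (lam_part : is_partition lam) (lam_d : row lam d = 0%N).
Hypothesis lam_n : (row lam 0 <= n)%N.
Local Notation s := (Defs.skew lam mu).
Local Notation N := (size (Defs.skew lam mu)).
Local Notation filling := {ffun 'I_d * 'I_n -> 'I_N.+1}.

Let lam_dec : nonincr (nth 0%N lam).
Proof. exact: partition_nonincr. Qed.

Definition filling_of (T : N.-tuple 'I_N.+1) : filling :=
  fill d n N (fun i j => sit_entry T (i.+1, j.+1)).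
Definition tuple_of (t : filling) : N.-tuple 'I_N.+1 :=
  [tuple inord (at_cell t (nth (0, 0)%N s k).1.-1 (nth (0, 0)%N s k).2.-1) | k < N].

Lemma sit_entry_le (T : N.-tuple 'I_N.+1) (c : nat * nat) : (sit_entry T c <= N)%N.
Proof.
rewrite /sit_entry; case: (ltnP (index c s) (size T)) => h; last by rewrite nth_default ?size_map.
by rewrite (nth_map ord0) // -ltnS.
Qed.

Lemma sit_entry_out (T : N.-tuple 'I_N.+1) (c : nat * nat) : c \notin s -> sit_entry T c = 0%N.
Proof.
by move=> cs; rewrite /sit_entry nth_default // size_map size_tuple memNindex.
Qed.

Lemma skew_bounds (i j : nat) : (row mu i <= j < row lam i)%N -> (i < d)%N /\ (j < n)%N.
Proof.
move=> /andP[_ jl]; split; last first.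
  by have := nonincr_leq lam_dec (leq0n i); lia.
by rewrite ltnNge; apply/negP => /(nonincr_leq lam_dec); rewrite lam_d; lia.
Qed.

Lemma at_filling_of (T : N.-tuple 'I_N.+1) (i j : nat) :
  at_cell (filling_of T) i j = sit_entry T (i.+1, j.+1).
Proof.
case: (boolP ((i.+1, j.+1) \in s)) => [|ijs].
  rewrite mem_skew => /skew_bounds[id jn].
  by rewrite at_cell_fill // sit_entry_le.
rewrite (sit_entry_out _ ijs); apply/eqP; rewrite -leqn0 leqNgt; apply/negP => gt0.
have [id jn] := at_cell_gt0 gt0; move: gt0.
by rewrite at_cell_fill ?sit_entry_le // sit_entry_out.
Qed.

Lemma sit_entry_tuple_of (t : filling) (i j : nat) :
  (i.+1, j.+1) \in s -> sit_entry (tuple_of t) (i.+1, j.+1) = at_cell t i j.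
Proof.
move=> ijs; have ks : (index (i.+1, j.+1) s < N)%N by rewrite index_mem.
rewrite /sit_entry (nth_map ord0) ?size_tuple //.
rewrite -[index _ _]/(nat_of_ord (Ordinal ks)) -tnth_nth tnth_mktuple /= nth_index //.
by rewrite inordK // ltnS at_cell_le.
Qed.

Lemma sit_entry_nth (T : N.-tuple 'I_N.+1) (k : 'I_N) :
  sit_entry T (nth (0, 0)%N s k) = tnth T k.
Proof.
by rewrite /sit_entry index_uniq ?skew_uniq // (nth_map ord0) ?size_tuple // -tnth_nth.
Qed.

Lemma tuple_of_filling (T : N.-tuple 'I_N.+1) : tuple_of (filling_of T) = T.
Proof.
apply: eq_from_tnth => k; apply: val_inj; rewrite tnth_mktuple /=.
have /skewP[i [j [cE _]]] : nth (0, 0)%N s k \in s by exact: mem_nth.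
rewrite inordK; last by rewrite ltnS at_cell_le.
by rewrite at_filling_of -sit_entry_nth cE.
Qed.

Lemma max_filling_of (T : N.-tuple 'I_N.+1) : max_entry (filling_of T) = sit_m T.
Proof.
apply: max_entry_eq => [i j|].
  rewrite at_filling_of; case: (boolP ((i.+1, j.+1) \in s)) => [ijs|/sit_entry_out -> //].
  exact: leq_bigmax_seq.
rewrite /sit_m; elim/big_ind: _ => // [x y hx hy|c _].
  by rewrite /maxn; case: ifP.
move=> gt0; have cs : c \in s by apply: contraLR gt0 => /sit_entry_out ->.
have [i [j [cE _]]] := skewP cs.
by exists i, j; rewrite at_filling_of cE.
Qed.

Lemma sit_filling_of (T : N.-tuple 'I_N.+1) :
  sit (nth 0%N lam) (nth 0%N mu) (filling_of T) = is_SIT T.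
Proof.
apply/(sitP lam_dec lam_d lam_n)/and4P; rewrite max_filling_of.
  move=> [T1 T2 T3 T4]; split.
  - apply/allP => c /skewP[i [j [-> ijP]]].
    by have := T1 i j; rewrite at_filling_of ijP.
  - apply/allP => c /skewP[i [j [-> ijP]]]; apply/allP => c' /skewP[i' [j' [-> ijP']]] /=.
    apply/implyP => /andP[/eqP[ii'] jj']; subst i'.
    by have := T2 i j j' jj'; rewrite !T1 ijP ijP' !at_filling_of; apply.
  - apply/allP => c /skewP[i [j [-> ijP]]]; apply/allP => c' /skewP[i' [j' [-> ijP']]] /=.
    apply/implyP => /andP[/eqP[jj'] ii']; subst j'.
    by have := T3 i i' j ii'; rewrite !T1 ijP ijP' !at_filling_of; apply.
  - apply/allP => k; rewrite mem_iota add1n ltnS => kP.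
    have [i [j E]] := T4 k kP; apply/hasP; exists (i.+1, j.+1); last by rewrite -E at_filling_of.
    by rewrite mem_skew -T1 E; case/andP: kP.
move=> [/allP T1 /allP T2 /allP T3 /allP T4].
have inside i j : (0 < at_cell (filling_of T) i j)%N = ((i.+1, j.+1) \in s).
  rewrite at_filling_of; apply/idP/idP => [|/T1 //].
  by apply: contraLR => /sit_entry_out ->.
split.
- by move=> i j; rewrite inside mem_skew.
- move=> i j j' jj'; rewrite !inside !at_filling_of => h h'.
  by have /allP/(_ _ h')/implyP := T2 _ h; apply; rewrite /= eqxx ltnS.
- move=> i i' j ii'; rewrite !inside !at_filling_of => h h'.
  by have /allP/(_ _ h')/implyP := T3 _ h; apply; rewrite /= eqxx ltnS.
- move=> k kP; have /hasP[c cs /eqP cE] : has (fun c => sit_entry T c == k) s.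
    by apply: T4; rewrite mem_iota add1n ltnS.
  have [i [j [ijE _]]] := skewP cs.
  by exists i, j; rewrite at_filling_of -ijE.
Qed.

Lemma filling_of_tuple (t : filling) :
  sit (nth 0%N lam) (nth 0%N mu) t -> filling_of (tuple_of t) = t.
Proof.
move=> /(sitP lam_dec lam_d lam_n)[T1 _ _ _]; apply: at_cell_inj => i j _ _.
rewrite at_filling_of; case: (boolP ((i.+1, j.+1) \in s)) => [/sit_entry_tuple_of -> //|ijs].
rewrite sit_entry_out //; apply/esym/eqP; rewrite -leqn0 leqNgt T1.
by rewrite -mem_skew.
Qed.

Lemma sit_nu_shape_below (T : N.-tuple 'I_N.+1) (k i : nat) : (0 < k)%N ->
  sit_nu T k i.+1 = shape_below (nth 0%N lam) (filling_of T) k i.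
Proof.
move=> k0; rewrite /sit_nu /shape_below -!sum1_count big_mkcond big_cells /=.
case: (ltnP i (size lam)) => il; last first.
  rewrite nth_default // big_nil big_nat big1 // => i' i'l.
  by rewrite big1 // => j _; rewrite eqSS ltn_eqF //; lia.
rewrite (bigD1_seq i) ?mem_index_iota ?iota_uniq //= [X in (_ + X)%N]big1; last first.
  by move=> i' i'i; rewrite big1 // => j _; rewrite eqSS (negbTE i'i).
rewrite addn0 [RHS]big_mkcond /index_iota subn0; apply: eq_big_seq => j; rewrite mem_iota add0n /= => jl.
rewrite eqxx /= mem_cells mem_skew at_filling_of; congr (if _ then _ else _).
case: (ltnP j (row mu i)) => jm /=; last by rewrite jl.
(* A cell of [mu] is not listed in the skew shape, so its entry is the default 0, which is below
   [k]. *)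
by rewrite sit_entry_out ?k0 // mem_skew; lia.
Qed.

Variables (R : fieldType) (beta : R).

Lemma LHS68_sit_sum :
  LHS68 beta d lam mu = sit_sum d n N (nth 0%N lam) (step_wt beta d (nth 0%N lam)) (nth 0%N mu).
Proof.
rewrite /sit_sum (reindex_onto filling_of tuple_of) => [|t]; last exact: filling_of_tuple.
apply: eq_big => [T|T _]; first by rewrite tuple_of_filling eqxx andbT sit_filling_of.
rewrite /sit_wt max_filling_of; apply: eq_big_nat => k /andP[k0 _].
congr (_ - 1)^-1; apply: eq_bigr => i _.
by rewrite sit_nu_shape_below.
Qed.
End SIT.

(** In a decreasing list the parts larger than [j] form an initial segment. *)
Lemma conj_partE (s : seq nat) (i j : nat) :
  is_partition s -> (i < conj_part s j.+1)%N = (j < row s i)%N.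
Proof.
case/andP => + _; rewrite /conj_part; elim: s i => [|x s IHs] i s_sorted /=.
  by rewrite nth_nil.
have xs : all (geq x) s by apply: order_path_min s_sorted => a b c /= h h'; exact: leq_trans h' h.
case: (ltnP j x) => jx /=; first by case: i => [|i] //=; rewrite add1n ltnS IHs // (path_sorted s_sorted).
have le_j y : y \in s -> (y <= j)%N by move=> /(allP xs) /= yx; exact: leq_trans yx jx.
rewrite add0n (_ : count _ s = 0%N).
  case: i => [|i] /=; first by rewrite [RHS]ltnNge jx.
  apply/esym/negbTE; rewrite -leqNgt; case: (ltnP i (size s)) => si; last by rewrite nth_default.
  exact/le_j/mem_nth.
by apply/eqP; rewrite -leqn0 leqNgt -has_count; apply/hasPn => y /le_j; rewrite -leqNgt.
Qed.

Lemma sumn_rows (d : nat) (s : seq nat) : (size s <= d)%N -> sumn s = (\sum_(i < d) row s i)%N.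
Proof.
move=> sd; rewrite sumnE (big_nth 0%N) -(big_mkord xpredT (fun i => row s i)).
rewrite [RHS](big_cat_nat (n := size s)) //= [X in (_ + X)%N]big_nat [X in (_ + X)%N]big1 ?addn0 //.
by move=> i /andP[si _]; rewrite nth_default.
Qed.

Lemma skew_size_mem (d : nat) (lam mu : seq nat) : (size lam <= d)%N ->
  (forall i, row mu i <= row lam i)%N ->
  skew_size d (nth 0%N lam) (nth 0%N mu) = size (Defs.skew lam mu).
Proof.
move=> lam_size mu_lam; rewrite size_filter -sum1_count big_mkcond big_cells.
rewrite (big_rows _ (fun i j => if (i.+1, j.+1) \notin cells mu then 1%N else 0%N) lam_size).
apply: eq_bigr => i _.
rewrite -(big_mkord xpredT (fun j => if (i.+1, j.+1) \notin cells mu then 1%N else 0%N)).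
rewrite -big_mkcond sum1_count /index_iota subn0.
rewrite (eq_count (a2 := predC (fun j => (j < row mu i)%N))) => [|j]; last by rewrite /= mem_cells.
have := count_predC (fun j => (j < row mu i)%N) (iota 0 (row lam i)).
by rewrite count_ltn_iota // size_iota; lia.
Qed.

(** * Set-valued tableaux as functions on cells and as sets of triples *)

Section SSVT.
Variables (d n : nat) (mu : seq nat).
Hypotheses (mu_part : is_partition mu) (mu_d : row mu d = 0%N) (mu_n : (row mu 0 <= n)%N).
Local Notation M := (size (cells mu)).
Local Notation triples := {set 'I_d * 'I_n.+1 * 'I_d}.

Definition values (U : triples) : {ffun 'I_M -> {set 'I_d}} :=
  [ffun k => [set r : 'I_d | has_entry U (mcell k).1.-1 (mcell k).2.-1 r]].
Definition triples_of (T : {ffun 'I_M -> {set 'I_d}}) : triples :=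
  [set t : 'I_d * 'I_n.+1 * 'I_d | [exists k : 'I_M, (mcell k == (t.1.1.+1, t.1.2.+1)) && (t.2 \in T k)]].

Let mu_dec : nonincr (nth 0%N mu).
Proof. exact: partition_nonincr. Qed.
Let mu_le i : (row mu i <= n.+1)%N.
Proof. exact: leqW (leq_trans (nonincr_leq mu_dec (leq0n i)) mu_n). Qed.

Lemma mcellP (k : 'I_M) : exists i j, mcell k = (i.+1, j.+1) /\ (j < row mu i)%N.
Proof. by apply: cellsP; exact: mem_nth. Qed.

Lemma mcell_index (i j : nat) : (j < row mu i)%N -> exists k : 'I_M, mcell k = (i.+1, j.+1).
Proof.
rewrite -mem_cells => ij; have kM : (index (i.+1, j.+1) (cells mu) < M)%N by rewrite index_mem.
by exists (Ordinal kM); rewrite /mcell /= nth_index.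
Qed.

Lemma mcell_inj : injective (@mcell mu).
Proof.
move=> k k' /eqP; rewrite /mcell nth_uniq ?cells_uniq // => /eqP.
exact: val_inj.
Qed.

Lemma mu_row_lt (i j : nat) : (j < row mu i)%N -> (i < d)%N.
Proof. by move=> jm; rewrite ltnNge; apply/negP => /(nonincr_leq mu_dec); rewrite mu_d; lia. Qed.

Lemma has_triples_of (T : {ffun 'I_M -> {set 'I_d}}) (k : 'I_M) (i j : nat) (r : 'I_d) :
  mcell k = (i.+1, j.+1) -> has_entry (triples_of T) i j r = (r \in T k).
Proof.
move=> kE; have jm : (j < row mu i)%N.
  by have [i' [j' []]] := mcellP k; rewrite kE => -[-> ->].
have id := mu_row_lt jm; have jn : (j < n.+1)%N by exact: leq_trans jm (mu_le i).
rewrite (has_entry_ord _ (Ordinal id) (Ordinal jn)) inE /=.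
apply/existsP/idP => [[k' /andP[/eqP k'E]]|rT]; last by exists k; rewrite kE eqxx.
by rewrite (mcell_inj (etrans k'E (esym kE))).
Qed.

Lemma values_triples_of (T : {ffun 'I_M -> {set 'I_d}}) : values (triples_of T) = T.
Proof.
apply/ffunP => k; rewrite ffunE; apply/setP => r; rewrite inE.
have [i [j [kE _]]] := mcellP k.
by rewrite kE /= (has_triples_of _ _ kE).
Qed.

Lemma triples_of_shape (T : {ffun 'I_M -> {set 'I_d}}) (i j r : nat) :
  has_entry (triples_of T) i j r -> (j < row mu i)%N.
Proof.
move=> h; have [id jn rd] := has_entry_lt h; move: h.
rewrite (has_entry_ord _ (Ordinal id) (Ordinal jn) (Ordinal rd)) inE /=.
case/existsP => k /andP[/eqP kE _].
by have [i' [j' []]] := mcellP k; rewrite kE => -[-> ->].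
Qed.

Lemma triples_of_values (U : triples) : svt d (nth 0%N mu) U -> triples_of (values U) = U.
Proof.
move=> /(svtP _ _ mu_le)[T1 _ _ _]; apply: has_entry_inj => i j r.
case: (ltnP r d) => rd; last first.
  by apply/idP/idP => /has_entry_lt[_ _]; rewrite ltnNge rd.
case: (ltnP j (row mu i)) => jm.
  have [k kE] := mcell_index jm.
  by rewrite (has_triples_of _ (Ordinal rd) kE) ffunE inE kE.
apply/idP/idP => [/triples_of_shape|/T1[_]]; by rewrite ltnNge jm.
Qed.

(** The hypothesis says that no triple of [U] lies outside [mu]. Comparisons of adjacent cells chain
    to distant ones through the cells between them, which belong to [mu] and are not empty. *)
Lemma is_SSVT_values (U : triples) : triples_of (values U) = U ->
  is_SSVT (values U) = svt d (nth 0%N mu) U.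
Proof.
move=> UE; have shape i j r : has_entry U i j r -> (j < row mu i)%N.
  by rewrite -UE; exact: triples_of_shape.
have valE k i j (r : 'I_d) : mcell k = (i.+1, j.+1) -> (r \in values U k) = has_entry U i j r.
  by move=> kE; rewrite ffunE inE kE.
have lt_d i j r : has_entry U i j r -> (r < d)%N by case/has_entry_lt.
apply/and3P/(svtP _ _ mu_le) => [[/forallP V1 /forallP V2 /forallP V3]|[T1 T2 T3 T4]].
  have T2 i j : (j < row mu i)%N -> exists r, has_entry U i j r.
    move=> jm; have [k kE] := mcell_index jm.
    by have /set0Pn[r] := V1 k; rewrite (valE _ _ _ _ kE); exists r.
  have adj_row i j r r' : has_entry U i j r -> has_entry U i j.+1 r' -> (r <= r')%N.
    move=> h h'; have [k kE] := mcell_index (shape _ _ _ h).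
    have [k' k'E] := mcell_index (shape _ _ _ h').
    have /forallP/(_ k')/implyP := V2 k; rewrite kE k'E !eqxx => /(_ isT)/forall_inP H.
    have := H (Ordinal (lt_d _ _ _ h)); rewrite (valE _ _ _ _ kE) => /(_ h)/forall_inP {}H.
    by have := H (Ordinal (lt_d _ _ _ h')); rewrite (valE _ _ _ _ k'E) => /(_ h').
  have adj_col i j r r' : has_entry U i j r -> has_entry U i.+1 j r' -> (r < r')%N.
    move=> h h'; have [k kE] := mcell_index (shape _ _ _ h).
    have [k' k'E] := mcell_index (shape _ _ _ h').
    have /forallP/(_ k')/implyP := V3 k; rewrite kE k'E !eqxx => /(_ isT)/forall_inP H.
    have := H (Ordinal (lt_d _ _ _ h)); rewrite (valE _ _ _ _ kE) => /(_ h)/forall_inP {}H.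
    by have := H (Ordinal (lt_d _ _ _ h')); rewrite (valE _ _ _ _ k'E) => /(_ h').
  split=> [i j r h|i j _ /T2 //|i j j' r r' h|i i' j r r' h].
  - by split; [exact: lt_d h | exact: shape h].
  - elim: j' r' => // j' IHj r' h'; rewrite ltnS leq_eqVlt => /predU1P[jE|jj'].
      by subst j'; exact: adj_row h h'.
    have [r'' h''] := T2 i j' (ltnW (shape _ _ _ h')).
    exact: leq_trans (IHj _ h'' jj') (adj_row _ _ _ _ h'' h').
  - elim: i' r' => // i' IHi r' h'; rewrite ltnS leq_eqVlt => /predU1P[iE|ii'].
      by subst i'; exact: adj_col h h'.
    have [r'' h''] := T2 i' j (leq_trans (shape _ _ _ h') (mu_dec i')).
    exact: ltn_trans (IHi _ h'' ii') (adj_col _ _ _ _ h'' h').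
split.
- apply/forallP => k; have [i [j [kE jm]]] := mcellP k.
  have [r h] := T2 i j (mu_row_lt jm) jm.
  by apply/set0Pn; exists (Ordinal (lt_d _ _ _ h)); rewrite (valE _ _ _ _ kE).
- apply/forallP => k; apply/forallP => k'; apply/implyP.
  have [i [j [kE jm]]] := mcellP k; have [i' [j' [k'E jm']]] := mcellP k'.
  rewrite kE k'E /= => /andP[/eqP[ii'] /eqP[jj']]; subst i' j'.
  apply/forall_inP => a; rewrite (valE _ _ _ _ kE) => h.
  apply/forall_inP => b; rewrite (valE _ _ _ _ k'E) => h'.
  exact: T3 h h' (ltnSn j).
- apply/forallP => k; apply/forallP => k'; apply/implyP.
  have [i [j [kE jm]]] := mcellP k; have [i' [j' [k'E jm']]] := mcellP k'.
  rewrite kE k'E /= => /andP[/eqP[ii'] /eqP[jj']]; subst i' j'.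
  apply/forall_inP => a; rewrite (valE _ _ _ _ kE) => h.
  apply/forall_inP => b; rewrite (valE _ _ _ _ k'E) => h'.
  exact: T4 h h' (ltnSn i).
Qed.

Lemma prod_values (R : fieldType) (U : triples) (F : nat -> nat -> nat -> R) :
  svt d (nth 0%N mu) U ->
  \prod_(k < M) \prod_(a in values U k) F (mcell k).1.-1 (mcell k).2.-1 a
  = \prod_(t in U) F t.1.1 t.1.2 t.2.
Proof.
move=> /(svtP _ _ mu_le)[T1 _ _ _].
have UE : U = entries d n.+1 (has_entry U).
  apply: has_entry_inj => i j r; rewrite has_entries.
  by case: (boolP (has_entry U i j r)) => [/has_entry_lt[-> -> ->]|]; rewrite ?andbF.
rewrite [in RHS]UE (prod_triples _ _ _ F).
pose h (c : nat * nat) := \prod_(a < d | has_entry U c.1.-1 c.2.-1 a) F c.1.-1 c.2.-1 a.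
transitivity (\prod_(c <- cells mu) h c).
  rewrite (big_nth (0, 0)%N) big_mkord; apply: eq_bigr => k _.
  by apply: eq_bigl => a; rewrite ffunE inE.
rewrite big_cells (big_rows _ _ (partition_size mu_part mu_d)) /=.
apply: eq_bigr => i _; rewrite /h /=.
rewrite (prod_ord_wide (F := fun j => \prod_(r < d | has_entry U i j r) F i j r) (mu_le i)) //.
by move=> j mj; rewrite big_pred0 // => r; apply/negbTE/negP => /T1[_]; rewrite ltnNge mj.
Qed.

Variables (R : fieldType) (beta : R) (lam : seq nat).
Hypothesis beta_unit : forall m : nat, 1 + beta * m%:R != 0.
Hypothesis beta_neq0 : beta != 0.

(** Each of the [ne T] entries absorbs one factor [- beta], which turns its weight into [entry_wt];
    the power [- sumn lam] remains. *)
Lemma SSVT_svt_sum :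
  \sum_(T : {ffun 'I_M -> {set 'I_d}} | is_SSVT T)
     ((- beta) ^ ((ne T)%:Z - (sumn lam)%:Z)
      * \prod_(k < M) \prod_(a in T k)
          (((part lam (d - a))%:R + ((mcell k).1)%:R - ((mcell k).2)%:R)
           / (1 + beta * ((part lam (d - a) + a.+1)%N)%:R)))
  = (- beta) ^- sumn lam
    * svt_sum (specX beta d (nth 0%N lam)) (specA beta) d n.+1 d (nth 0%N mu).
Proof.
rewrite /svt_sum mulr_sumr (reindex_onto values triples_of) => [|T _]; last first.
  exact: values_triples_of.
apply: eq_big => [U|U /andP[U_ssvt /eqP UE]].
  apply/andP/idP => [[U_ssvt /eqP UE]|U_svt]; first by rewrite -is_SSVT_values.
  by rewrite is_SSVT_values triples_of_values ?eqxx.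
have U_svt : svt d (nth 0%N mu) U by rewrite -is_SSVT_values.
have nbeta0 : - beta != 0 by rewrite oppr_eq0.
rewrite expfzDr // -exprnN mulrAC [LHS]mulrC; congr (_ * _).
rewrite -(prod_values (fun i j r => entry_wt (specX beta d (nth 0%N lam)) (specA beta) r i j) U_svt).
rewrite [_ ^ _]expr_sum -big_split /=; apply: eq_bigr => k _.
rewrite -prodr_const -big_split /=; apply: eq_bigr => a ak.
have [i [j [kE jm]]] := mcellP k.
have h : has_entry U i j a by move: ak; rewrite ffunE inE kE.
rewrite kE /= entry_wt_spec //; last exact: svt_row_le mu_dec mu_le U_svt h.
have -> : part lam (d - a) = row lam (d.-1 - a) by rewrite /part; congr (row lam _); lia.
by rewrite mulrA; congr (_ * _ / _); rewrite -[in LHS]natr1 -[j.+1%:R]natr1; ring.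
Qed.
End SSVT.

(** * The constant in front of the sum is the inverse of [S_lam] *)

Section Prefactor.
Variables (R : fieldType) (beta : R) (d : nat) (lam : seq nat).
Hypothesis beta_unit : forall m : nat, 1 + beta * m%:R != 0.
Hypothesis beta_neq0 : beta != 0.
Hypothesis natr_neq0 : forall m : nat, m.+1%:R != 0 :> R.
Hypotheses (lam_part : is_partition lam) (lam_d : row lam d = 0%N).
Local Notation S := (svt_sum (specX beta d (nth 0%N lam)) (specA beta) d (row lam 0).+2 d (nth 0%N lam)).

Let conj_rows i j : (i < conj_part lam j.+1)%N = (j < row lam i)%N.
Proof. exact: conj_partE. Qed.

Lemma svt_sum_lamE : S = \prod_(p < d) \prod_(j < row lam p)
  (- beta * (hook lam (p.+1, j.+1))%:R / (1 + beta * (row lam p + (d - p))%:R)).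
Proof.
rewrite (svt_sum_lam beta_unit (partition_nonincr lam_part) lam_d _ conj_rows) //.
apply: eq_bigr => p _; apply: eq_bigr => j _; congr (_ * _%:R / _).
by rewrite /hook /part /=; have := ltn_ord j; lia.
Qed.

Lemma svt_sum_lam_neq0 : S != 0.
Proof.
rewrite svt_sum_lamE; apply/prodf_neq0 => p _; apply/prodf_neq0 => j _.
rewrite !mulf_neq0 ?oppr_eq0 ?invr_eq0 //.
by rewrite /hook addn1.
Qed.

(** Row by row: in row [i] of [S] every cell contributes its hook length, a factor [- beta] and the
    same denominator, and each of these has its inverse in the other factors. *)
Lemma prefactorK (v : R) :
  \prod_(i < d) (1 + beta * ((part lam i.+1 + (d - i))%N)%:R) ^+ part lam i.+1
  * ((- beta) ^- sumn lam * v) * (\prod_(c <- cells lam) ((hook lam c)%:R)^-1) * S = v.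
Proof.
have lam_size := partition_size lam_part lam_d.
have nb0 : - beta != 0 by rewrite oppr_eq0.
set P := \prod_(i < d) _; set H := \prod_(c <- _) _.
suff E : P * (- beta) ^- sumn lam * H * S = 1.
  by transitivity (P * (- beta) ^- sumn lam * H * S * v); [ring | rewrite E mul1r].
rewrite /P /H svt_sum_lamE (sumn_rows lam_size) big_cells (big_rows _ _ lam_size) /=.
rewrite expr_sum -prodfV -!big_split big1 //= => i _.
rewrite -mulrA -big_split /=.
rewrite (eq_bigr (fun=> - beta / (1 + beta * (row lam i + (d - i))%:R))) => [|j _]; last first.
  have h0 : (hook lam (i.+1, j.+1))%:R != 0 :> R by rewrite /hook addn1.
  by rewrite -[- beta * _ / _]mulrA mulrCA mulKf.
rewrite prodr_const card_ord expr_div_n /part /=.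
by field; rewrite !expf_neq0.
Qed.
End Prefactor.

(** * Genericity of the indeterminate and the theorem *)

Lemma betaX_unit (m : nat) : 1 + betaX * m%:R != 0.
Proof.
have -> : 1 + betaX * m%:R = tofrac (1 + 'X * m%:R : {poly rat}).
  by rewrite rmorphD rmorph1 rmorphM rmorph_nat.
rewrite tofrac_eq0; apply/eqP => /(congr1 (fun p => p.[0])) /eqP.
by rewrite !hornerE.
Qed.

Lemma betaX_neq0 : betaX != 0.
Proof. by rewrite tofrac_eq0 polyX_eq0. Qed.

Lemma fracX_natr_neq0 (m : nat) : m.+1%:R != 0 :> {fraction {poly rat}}.
Proof.
rewrite -(rmorph_nat (@tofrac {poly rat})) tofrac_eq0 -(rmorph_nat polyC) polyC_eq0.
by rewrite pnatr_eq0.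
Qed.

(* Evaluate at [beta = 1]. *)
Lemma betaX_generic (d : nat) (f g : nat -> nat) :
  \prod_(i < d) (1 + betaX * (f i)%:R) = \prod_(i < d) (1 + betaX * (g i)%:R) ->
  (\prod_(i < d) (f i).+1 = \prod_(i < d) (g i).+1)%N.
Proof.
have E h : \prod_(i < d) (1 + betaX * (h i)%:R)
    = tofrac (\prod_(i < d) (1 + 'X * (h i)%:R) : {poly rat}).
  rewrite rmorph_prod; apply: eq_bigr => i _.
  by rewrite rmorphD rmorph1 rmorphM rmorph_nat.
have E1 h : (\prod_(i < d) (1 + 'X * (h i)%:R) : {poly rat}).[1]
    = (\prod_(i < d) (h i).+1)%:R.
  rewrite horner_prod natr_prod; apply: eq_bigr => i _.
  rewrite -polyC_natr !hornerE /= ?mul1r.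
  by rewrite nat1r.
rewrite !E => /eqP; rewrite tofrac_eq => /eqP /(congr1 (fun p => p.[1])).
by rewrite !E1 => /eqP; rewrite eqr_nat => /eqP.
Qed.

Theorem theorem6p8 (d : nat) (lam mu : seq nat) :
  (1 <= d)%N ->
  is_partition lam -> is_partition mu ->
  (forall i, part mu i <= part lam i)%N ->
  (size lam <= d)%N ->
  LHS68 betaX d lam mu = RHS68 betaX d lam mu.
Proof.
move=> _ lam_part mu_part mu_lam lam_size.
have lam_d : row lam d = 0%N by rewrite nth_default.
have row_le i : (row mu i <= row lam i)%N by exact: mu_lam i.+1.
have mu_d : row mu d = 0%N by apply/eqP; have := row_le d; rewrite lam_d leqn0.
have lam_dec := partition_nonincr lam_part.
have mu_dec := partition_nonincr mu_part.
rewrite /RHS68 (SSVT_svt_sum mu_part mu_d (leqW (row_le 0%N)) lam betaX_unit betaX_neq0).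
rewrite (LHS68_sit_sum mu lam_part lam_d (leqnSn _)).
(* After multiplication by [S_lam], both sides equal [S_mu]: the left by [skew_identity], the right
   by [prefactorK]. *)
apply: (mulIf (svt_sum_lam_neq0 betaX_unit betaX_neq0 fracX_natr_neq0 lam_part lam_d)).
rewrite (skew_identity betaX_unit (betaX_generic (d := d)) lam_dec lam_d mu_dec row_le).
  by rewrite (prefactorK betaX_unit betaX_neq0 fracX_natr_neq0 lam_part lam_d).
by rewrite (skew_size_mem lam_size row_le).
Qed.
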